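(* The set $\mathcal{WT}_3$ of cubic WT-critical portraits is of first category in $\mathcal A_3$.
   Context: $\mathbb S=\mathbb R/\mathbb Z$, $\sigma_3(x)=3x\bmod1$. A cubic lamination is an equivalence relation $\sim$ on $\mathbb S$ with closed graph, pairwise disjoint convex hulls of distinct classes in the closed unit disk, classes totally disconnected unless $\mathbb S$ is one class, $\sigma_3$-images of classes being classes, $\sigma_3$-preimages of classes being unions of classes, and such that for each class $\mathbf g$ with at least 3 points and each component $(s,t)$ of $\mathbb S\setminus\mathbf g$, $(\sigma_3(s),\sigma_3(t))$ is a component of $\mathbb S\setminus\sigma_3(\mathbf g)$. A class is critical if $\sigma_3$ is not injective on it, precritical if some forward image is critical, preperiodic if $\sigma_3^i(\mathbf g)=\sigma_3^j(\mathbf g)$ for some $0\le i<j$; a class with at least three points is a wandering gap (wandering $k$-gon) if it is neither preperiodic nor precritical. A WT-lamination is a lamination with a wandering gap. A cubic critical portrait is a collection $\Theta=\{\Theta_1,\dots,\Theta_n\}$ of finite subsets of $\mathbb S$ whose convex hulls have boundaries made of critical chords (chords $\{a,b\}$ with $\sigma_3(a)=\sigma_3(b)$), are pairwise disjoint, and $\sum(|\Theta_i|-1)=2$; $\mathcal A_3$ is the set of them, with the compact-unlinked topology generated by the subbasis $V_X=\{\Theta:X\subset L\text{ for some }\Theta\text{-unlinked class }L\}$, $X\subset\mathbb S$ closed, where $\Theta$-unlinked classes are the classes of the relation on $\mathbb S\setminus\bigcup\Theta_i$ declaring $\alpha,\beta$ equivalent when the chord $\{\alpha,\beta\}$ is disjoint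 from every $\mathrm{Ch}(\Theta_i)$. $\Theta$ is a WT-critical portrait if there is a WT-lamination $\sim$ compatible with $\Theta$, i.e., each $\Theta_i$ is contained in a $\sim$-class. *)

(* Defs.v *)
From Stdlib Require Import Reals.
From mathcomp Require Import all_boot finmap.
From mathcomp Require Import Rstruct.

Set Implicit Arguments.
Unset Strict Implicit.
Unset Printing Implicit Defensive.

Local Open Scope fset_scope.
Local Open Scope R_scope.

(* ---------- The circle S = R/Z, represented by [0,1) ---------- *)

Definition inS (x : R) : Prop := 0 <= x /\ x < 1.

Definition sigma3 (x : R) : R := frac_part (3 * x).

Definition cdist (x y : R) : R := Rmin (Rabs (x - y)) (1 - Rabs (x - y)).

Definition S_open (U : R -> Prop) : Prop :=
  (forall x, U x -> inS x) /\
  forall x, U x -> exists eps, 0 < eps /\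
     forall y, inS y -> cdist x y < eps -> U y.

Definition S_closed (X : R -> Prop) : Prop :=
  (forall x, X x -> inS x) /\ S_open (fun x => inS x /\ ~ X x).

Definition S_connected (C : R -> Prop) : Prop :=
  ~ exists U V, S_open U /\ S_open V /\
      (forall x, C x -> U x \/ V x) /\
      (exists x, C x /\ U x) /\ (exists x, C x /\ V x) /\
      (forall x, C x -> U x -> V x -> False).

Definition totally_disconnected (A : R -> Prop) : Prop :=
  forall C, (forall x, C x -> A x) -> S_connected C ->
    forall x y, C x -> C y -> x = y.

(* the open counterclockwise arc (s,t); (s,s) is S minus {s} *)
Definition open_arc (s t x : R) : Prop :=
  inS x /\ x <> s /\
  ((s < t -> s < x /\ x < t) /\ (t < s -> s < x \/ x < t)).

(* (s,t) is a component of S \ A (A a closed subset of S) *)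
Definition hole (A : R -> Prop) (s t : R) : Prop :=
  A s /\ A t /\ forall x, open_arc s t x -> ~ A x.

Definition emb (x : R) : R * R := (cos (2 * PI * x), sin (2 * PI * x)).

Definition ConvHull (A : R -> Prop) (p : R * R) : Prop :=
  exists (n : nat) (w t : nat -> R),
    (forall i, (i <= n)%nat -> 0 <= w i /\ A (t i)) /\
    sum_f_R0 w n = 1 /\
    fst p = sum_f_R0 (fun i => w i * fst (emb (t i))) n /\
    snd p = sum_f_R0 (fun i => w i * snd (emb (t i))) n.

Definition hulls_disjoint (A B : R -> Prop) : Prop :=
  forall p, ConvHull A p -> ConvHull B p -> False.

Definition image3 (A : R -> Prop) : R -> Prop :=
  fun w => exists y, A y /\ w = sigma3 y.

Definition iter_image3 (n : nat) (A : R -> Prop) : R -> Prop :=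
  Nat.iter n image3 A.

Definition set_eq (A B : R -> Prop) : Prop := forall x, A x <-> B x.

Definition has3 (A : R -> Prop) : Prop :=
  exists a b c, A a /\ A b /\ A c /\ a <> b /\ a <> c /\ b <> c.

Definition is_lamination (lam : R -> R -> Prop) : Prop :=
  (forall x y, lam x y -> inS x /\ inS y) /\
  (forall x, inS x -> lam x x) /\
  (forall x y, lam x y -> lam y x) /\
  (forall x y z, lam x y -> lam y z -> lam x z) /\
  (forall x y, inS x -> inS y -> ~ lam x y ->
     exists eps, 0 < eps /\ forall x' y', inS x' -> inS y' ->
       cdist x x' < eps -> cdist y y' < eps -> ~ lam x' y') /\
  (forall x y, inS x -> inS y -> ~ lam x y -> hulls_disjoint (lam x) (lam y)) /\
  ((forall x y, inS x -> inS y -> lam x y) \/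
   (forall x, inS x -> totally_disconnected (lam x))) /\
  (forall x, inS x -> exists z, inS z /\ set_eq (image3 (lam x)) (lam z)) /\
  (forall x y z, lam y z -> lam x (sigma3 y) -> lam x (sigma3 z)) /\
  (forall x, inS x -> has3 (lam x) ->
     forall s t, hole (lam x) s t -> hole (image3 (lam x)) (sigma3 s) (sigma3 t)).

Definition critical (A : R -> Prop) : Prop :=
  exists a b, A a /\ A b /\ a <> b /\ sigma3 a = sigma3 b.

Definition precritical (A : R -> Prop) : Prop :=
  exists n, critical (iter_image3 n A).

Definition preperiodic (A : R -> Prop) : Prop :=
  exists i j, (i < j)%nat /\ set_eq (iter_image3 i A) (iter_image3 j A).

Definition wandering_gap (A : R -> Prop) : Prop :=
  has3 A /\ ~ preperiodic A /\ ~ precritical A.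

Definition WT_lamination (lam : R -> R -> Prop) : Prop :=
  is_lamination lam /\ exists x, inS x /\ wandering_gap (lam x).

Definition portrait := {fset {fset R}}.

Definition fmem (A : {fset R}) : R -> Prop := fun x => x \in A.

Definition is_crit_portrait (Th : portrait) : Prop :=
  (forall A, A \in Th -> forall x, x \in A -> inS x) /\
  (forall A, A \in Th -> (2 <= #|` A|)%N) /\
  (* the boundary of Ch(A) consists of critical chords: its edges are the
     chords joining cyclically consecutive points of A *)
  (forall A, A \in Th -> forall a b, a \in A -> b \in A -> a <> b ->
      hole (fmem A) a b -> sigma3 a = sigma3 b) /\
  (forall A B, A \in Th -> B \in Th -> A <> B -> hulls_disjoint (fmem A) (fmem B)) /\
  (\sum_(A <- Th) (#|` A| - 1))%N = 2%N.

Definition A3 : portrait -> Prop := is_crit_portrait.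

Definition compatible (Th : portrait) (lam : R -> R -> Prop) : Prop :=
  forall A, A \in Th -> exists x, forall a, a \in A -> lam x a.

Definition WT3 : portrait -> Prop :=
  fun Th => A3 Th /\ exists lam, WT_lamination lam /\ compatible Th lam.

Definition in_union (Th : portrait) (x : R) : Prop :=
  exists A, A \in Th /\ x \in A.

Definition unlinked (Th : portrait) (a b : R) : Prop :=
  inS a /\ inS b /\ ~ in_union Th a /\ ~ in_union Th b /\
  forall A, A \in Th -> hulls_disjoint (fun x => x = a \/ x = b) (fmem A).

Definition V (X : R -> Prop) : portrait -> Prop :=
  fun Th => exists a, inS a /\ ~ in_union Th a /\ forall x, X x -> unlinked Th a x.

Definition A3_open (U : portrait -> Prop) : Prop :=
  (forall Th, U Th -> A3 Th) /\
  forall Th, U Th -> exists Xs : list (R -> Prop),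
    (forall X, List.In X Xs -> S_closed X) /\
    (forall X, List.In X Xs -> V X Th) /\
    (forall Th', A3 Th' -> (forall X, List.In X Xs -> V X Th') -> U Th').

Definition A3_closure (N : portrait -> Prop) : portrait -> Prop :=
  fun Th => A3 Th /\ forall U, A3_open U -> U Th -> exists Th', U Th' /\ N Th'.

Definition A3_interior (N : portrait -> Prop) : portrait -> Prop :=
  fun Th => exists U, A3_open U /\ U Th /\ forall Th', U Th' -> N Th'.

Definition nowhere_dense (N : portrait -> Prop) : Prop :=
  (forall Th, N Th -> A3 Th) /\ forall Th, ~ A3_interior (A3_closure N) Th.

Definition first_category (M : portrait -> Prop) : Prop :=
  exists N : nat -> portrait -> Prop,
    (forall n, nowhere_dense (N n)) /\
    forall Th, M Th <-> exists n, N n Th.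

(* Main.v *)
(** A wandering gap contains a triangle with sides of length at least 1/n for
    some n, so it suffices to see that the portraits having a compatible
    lamination with such a wandering triangle are nowhere dense for each n.
    In every open set of portraits there is one, with critical chords
    {a, a + 1/3} and {b, b + 1/3}, for which a and b are strictly preperiodic
    and eventually mapped to a periodic point p that no periodic leaf unlinked
    with the two chords can join to another point.  Suppose that wandering
    triangles with sides at least 1/n existed for portraits converging to this
    one, and let T be a limit triangle.  The images of T cannot stay away from
    degenerate triangles, for two of them would then be so close to each other
    that the images of nearby wandering triangles would cross.  When a side
    becomes short for the first time, the previous image of it is close to a
    critical chord, and the third vertex stays away from this chord since a and
    b are not recurrent.  Hence some limit triangle has a critical chord as a
    side.  Its image under a large iterate is a leaf {p, z}; the nearby wandering
    triangles have a short side next to p that is repelled from p, and as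
    their images do not cross, the successive images of z are monotone around
    the circle and reach a fixed point w of the return map to p.  Then {p, w}
    is a periodic leaf, a contradiction. *)

From Stdlib Require Import Reals Lra Lia ZArith Classical.
From mathcomp Require Import all_boot finmap.
From mathcomp Require Import Rstruct.
Require Import Defs.

Set Implicit Arguments.
Unset Strict Implicit.
Unset Printing Implicit Defensive.

Local Open Scope fset_scope.
Local Open Scope R_scope.

(** * Arithmetic on the circle by integer translates of reals *)

(** [near_int d (x - y)] says that x and y are less than d apart in R/Z. With arbitrary reals in
    place of representatives in [0, 1), tripling is plain multiplication and nothing special happens
    at 0. *)
Definition near_int (d x : R) : Prop :=
  exists k : Z, IZR k - d < x /\ x < IZR k + d.

Definition eq_mod1 (x y : R) : Prop := exists k : Z, x - y = IZR k.

Ltac pushZ := rewrite ?(plus_IZR, minus_IZR, opp_IZR, mult_IZR).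

Lemma near_int_mono d e x : d <= e -> near_int d x -> near_int e x.
Proof. by move=> de [k Hk]; exists k; lra. Qed.

Lemma near_int_opp d x : near_int d x -> near_int d (- x).
Proof. by move=> [k Hk]; exists (Z.opp k); pushZ; lra. Qed.

Lemma near_int_sym d x y : near_int d (x - y) -> near_int d (y - x).
Proof. by move=> /near_int_opp; have -> : - (x - y) = y - x by lra. Qed.

Lemma near_int_add d e x y z :
  near_int d x -> near_int e y -> z = x + y -> near_int (d + e) z.
Proof. by move=> [k Hk] [l Hl] ->; exists (Z.add k l); pushZ; lra. Qed.

Lemma near_int_mul3 d x n : near_int d x -> near_int (3 ^ n * d) (3 ^ n * x).
Proof.
elim: n => [|n IH] H; first by rewrite /= !Rmult_1_l.
by have [k Hk] := IH H; exists (Z.mul 3 k); pushZ => /=; lra.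
Qed.

Lemma eq_mod1_refl x : eq_mod1 x x.
Proof. by exists Z0; lra. Qed.

Lemma eq_mod1_sym x y : eq_mod1 x y -> eq_mod1 y x.
Proof. by move=> [k Hk]; exists (Z.opp k); pushZ; lra. Qed.

Lemma eq_mod1_trans y x z : eq_mod1 x y -> eq_mod1 y z -> eq_mod1 x z.
Proof. by move=> [k Hk] [l Hl]; exists (Z.add k l); pushZ; lra. Qed.

Lemma eq_mod1_mul3 x y n : eq_mod1 x y -> eq_mod1 (3 ^ n * x) (3 ^ n * y).
Proof.
elim: n => [|n IH] H; first by rewrite /= !Rmult_1_l.
by have [k Hk] := IH H; exists (Z.mul 3 k); pushZ => /=; lra.
Qed.

Lemma near_int_eq_mod1 d x y : eq_mod1 x y -> near_int d x -> near_int d y.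
Proof. by move=> [k Hk] [l Hl]; exists (Z.sub l k); pushZ; lra. Qed.

Lemma eq_mod1_near d x y : 0 < d -> eq_mod1 x y -> near_int d (x - y).
Proof. by move=> d0 [k Hk]; exists k; lra. Qed.

Lemma lift_ge x u : exists i : Z, x <= u + IZR i /\ u + IZR i < x + 1.
Proof.
exists (Z.opp (Int_part (u - x))); have := base_Int_part (u - x).
by pushZ; lra.
Qed.

Lemma lift_gt x u : ~ eq_mod1 x u ->
  exists i : Z, x < u + IZR i /\ u + IZR i < x + 1.
Proof.
move=> H; have [i Hi] := lift_ge x u; exists i.
suff : x <> u + IZR i by lra.
by move=> E; apply: H; exists i; lra.
Qed.

Lemma IZR_lt_succ (k l : Z) : IZR k < IZR l + 1 -> (k <= l)%Z.
Proof.
move=> H; have : IZR k < IZR (Z.add l 1) by pushZ; lra.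
by move/lt_IZR; lia.
Qed.

Lemma not_eq_mod1_far x y : ~ eq_mod1 x y ->
  exists d, 0 < d /\ ~ near_int d (x - y).
Proof.
move=> H; have [i Hi] := lift_gt (fun E => H (eq_mod1_sym E)).
pose c := x + IZR i - y.
exists (Rmin c (1 - c)); split; first by apply: Rmin_glb_lt; rewrite /c; lra.
have := Rmin_l c (1 - c); have := Rmin_r c (1 - c); rewrite {1 3}/c.
move=> m1 m2 [k Hk].
have A : IZR (Z.add k i) < IZR 0 + 1 by pushZ; rewrite /c in Hk m1 m2; lra.
have B : IZR 1 < IZR (Z.add k i) + 1 by pushZ; rewrite /c in Hk m1 m2; lra.
by move: (IZR_lt_succ A) (IZR_lt_succ B); lia.
Qed.

(** The residue modulo 3 of the integer near [3 * x] selects one of the three inverse branches of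
    tripling; residue 2 appears as [x + 1 / 3] close to the next integer. *)
Lemma near_int_third d x : near_int d (3 * x) ->
  near_int (d / 3) x \/ near_int (d / 3) (x - 1 / 3) \/ near_int (d / 3) (x + 1 / 3).
Proof.
move=> [k Hk].
have E := Z.div_mod k 3 ltac:(lia); have M := Z.mod_pos_bound k 3 ltac:(lia).
set l := Z.div k 3 in E; set m := Z.modulo k 3 in E M.
have Ek : IZR k = 3 * IZR l + IZR m by rewrite E; pushZ; lra.
have : (m = 0 \/ m = 1 \/ m = 2)%Z by lia.
case=> [Em|[Em|Em]]; rewrite Em in Ek.
- by left; exists l; lra.
- by right; left; exists l; lra.
- by right; right; exists (Z.add l 1); pushZ; lra.
Qed.

Lemma eq_mod1_third x y : eq_mod1 (3 * x) (3 * y) ->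
  eq_mod1 x y \/ eq_mod1 x (y + 1 / 3) \/ eq_mod1 y (x + 1 / 3).
Proof.
move=> [k Hk].
have E := Z.div_mod k 3 ltac:(lia); have M := Z.mod_pos_bound k 3 ltac:(lia).
set l := Z.div k 3 in E; set m := Z.modulo k 3 in E M.
have Ek : IZR k = 3 * IZR l + IZR m by rewrite E; pushZ; lra.
have : (m = 0 \/ m = 1 \/ m = 2)%Z by lia.
case=> [Em|[Em|Em]]; rewrite Em in Ek.
- by left; exists l; lra.
- by right; left; exists l; lra.
- by right; right; exists (Z.opp (Z.add l 1)); pushZ; lra.
Qed.

Lemma pow3_gt0 n : 0 < 3 ^ n.
Proof. by apply: pow_lt; lra. Qed.

Lemma pow3_IZR n : exists z : Z, IZR z = 3 ^ n.
Proof.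
elim: n => [|n [z Hz]]; first by exists 1%Z.
by exists (Z.mul 3 z); rewrite mult_IZR Hz.
Qed.

Lemma pow3_ge1 n : 1 <= 3 ^ n.
Proof. by apply: pow_R1_Rle; lra. Qed.

(** * Crossing chords of the circle *)

Definition cyc4 (x u y v : R) : Prop := exists i j k : Z,
  x < u + IZR i /\ u + IZR i < y + IZR j /\ y + IZR j < v + IZR k /\ v + IZR k < x + 1.

(* the chords {x,y} and {u,v} of R/Z cross inside the open disk *)
Definition linked (x y u v : R) : Prop := cyc4 x u y v \/ cyc4 x v y u.

(** The four consecutive gaps are at least e, and moving each point by less than e / 2 changes a gap
    by less than e. Openness of crossing is what lets non-crossing pass to limits. *)
Lemma cyc4_open x u y v : cyc4 x u y v -> exists e, 0 < e /\
  forall x' u' y' v', near_int e (x' - x) -> near_int e (u' - u) ->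
    near_int e (y' - y) -> near_int e (v' - v) -> cyc4 x' u' y' v'.
Proof.
move=> [i [j [k [H1 [H2 [H3 H4]]]]]].
pose e1 := Rmin (u + IZR i - x) (y + IZR j - (u + IZR i)).
pose e2 := Rmin (v + IZR k - (y + IZR j)) (x + 1 - (v + IZR k)).
pose e := Rmin e1 e2.
have e0 : 0 < e by rewrite /e /e1 /e2; repeat apply: Rmin_glb_lt; lra.
have [A1 A2] : e <= e1 /\ e <= e2 by split; [apply: Rmin_l | apply: Rmin_r].
have B1 : e1 <= u + IZR i - x := Rmin_l _ _.
have B2 : e1 <= y + IZR j - (u + IZR i) := Rmin_r _ _.
have B3 : e2 <= v + IZR k - (y + IZR j) := Rmin_l _ _.
have B4 : e2 <= x + 1 - (v + IZR k) := Rmin_r _ _.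
exists (e / 2); split; first by lra.
move=> x' u' y' v' [kx Hx] [ku Hu] [ky Hy] [kv Hv].
exists (Z.add (Z.sub i ku) kx), (Z.add (Z.sub j ky) kx), (Z.add (Z.sub k kv) kx).
by pushZ; lra.
Qed.

Lemma linked_open x y u v : linked x y u v -> exists e, 0 < e /\
  forall x' y' u' v', near_int e (x' - x) -> near_int e (y' - y) ->
    near_int e (u' - u) -> near_int e (v' - v) -> linked x' y' u' v'.
Proof.
case=> /cyc4_open [e [e0 H]]; exists e; split=> // x' y' u' v' Hx Hy Hu Hv.
- by left; apply: H.
- by right; apply: H.
Qed.

Lemma linked_eq_mod1 x y u v x' y' u' v' :
  eq_mod1 x' x -> eq_mod1 y' y -> eq_mod1 u' u -> eq_mod1 v' v ->
  linked x y u v -> linked x' y' u' v'.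
Proof.
move=> Hx Hy Hu Hv /linked_open [e [e0 H]].
by apply: H; apply: eq_mod1_near.
Qed.

Lemma cyc4_opp x u y v : cyc4 (- x) (- u) (- y) (- v) -> cyc4 x v y u.
Proof.
move=> [i [j [k H]]].
exists (Z.sub 1 k), (Z.sub 1 j), (Z.sub 1 i); pushZ; lra.
Qed.

Lemma linked_opp x y u v : linked (- x) (- y) (- u) (- v) -> linked x y u v.
Proof. by case=> /cyc4_opp; [right | left]. Qed.

Lemma cyc4_rot x u y v : cyc4 x u y v -> cyc4 u y v x.
Proof.
move=> [i [j [k H]]].
exists (Z.sub j i), (Z.sub k i), (Z.sub 1 i); pushZ; lra.
Qed.

Lemma linked_sym x y u v : linked x y u v -> linked u v x y.
Proof.
case=> H; first by right; apply: cyc4_rot.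
by left; do 3!apply: cyc4_rot.
Qed.

Lemma linked_swap_r x y u v : linked x y u v -> linked x y v u.
Proof. by case; [right | left]. Qed.

(** The cyclic order is x, x + s, y, y + t, because both arcs between x and y have length at least
    d. *)
Lemma linked_parallel d x y x' y' : ~ near_int d (x - y) ->
  (exists s, 0 < s /\ s < d /\ eq_mod1 x' (x + s)) ->
  (exists s, 0 < s /\ s < d /\ eq_mod1 y' (y + s)) -> linked x y x' y'.
Proof.
move=> far [s [s0 [sd Ex]]] [t [t0 [td Ey]]].
have [j Hj] := lift_ge x y.
have far1 : d <= y + IZR j - x.
  case: (Rle_lt_dec d (y + IZR j - x)) => // L.
  by case: far; exists j; lra.
have far2 : y + IZR j - x <= 1 - d.
  case: (Rle_lt_dec (y + IZR j - x) (1 - d)) => // L.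
  by case: far; exists (Z.sub j 1); pushZ; lra.
apply: (@linked_eq_mod1 x y (x + s) (y + t)) => //; try exact: eq_mod1_refl.
by left; exists Z0, j, j; lra.
Qed.

(** A chord {u, v} of length about 1/3 that does not cross {c, c + 1/3} has u near c or in the arc
    from c + 1/3 to c + 2/3 + d. For c = a and c = b these arcs are disjoint, since d is at most the
    margin m. *)
Lemma nearly_critical (a b m d u v : R) :
  a + 1 / 3 + m <= b -> b <= a + 2 / 3 - m -> 0 < d -> d <= m -> d <= 1 / 9 ->
  ~ linked u v a (a + 1 / 3) -> ~ linked u v b (b + 1 / 3) ->
  near_int d (v - u - 1 / 3) -> near_int d (u - a) \/ near_int d (u - b).
Proof.
move=> Hab Hba d0 dm d9 Na Nb [k Hk].
have key c : ~ linked u v c (c + 1 / 3) -> near_int d (u - c) \/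
    exists i, c + 1 / 3 <= u + IZR i /\ u + IZR i < c + 2 / 3 + d.
  move=> N; have [i Hi] := lift_ge c u.
  have [j Ej] : exists j, j = Z.sub i k by eexists.
  have EjR : IZR j = IZR i - IZR k by rewrite Ej; pushZ.
  case: (Rlt_le_dec (u + IZR i) (c + d)) => L1.
    by left; exists (Z.opp i); pushZ; lra.
  case: (Rlt_le_dec (c + 1 - d) (u + IZR i)) => L2.
    by left; exists (Z.sub 1 i); pushZ; lra.
  right; exists i; split.
  - case: (Rle_lt_dec (c + 1 / 3) (u + IZR i)) => // L3.
    case: N; apply: linked_sym; left.
    by exists i, Z0, j; lra.
  - case: (Rlt_le_dec (u + IZR i) (c + 2 / 3 + d)) => // L3.
    case: N; apply: linked_sym; right.
    by exists (Z.sub j 1), Z0, i; pushZ; lra.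
case: (key a Na) => [|[i Hi]]; first by left.
case: (key b Nb) => [|[j Hj]]; first by right.
exfalso.
have A : IZR i < IZR j + 1 by lra.
have B : IZR j < IZR i + 1 by lra.
have E : i = j by move: (IZR_lt_succ A) (IZR_lt_succ B); lia.
by rewrite E in Hi; lra.
Qed.

(** If u were congruent to neither a nor b, [nearly_critical] would fail for d below the distances
    of u from both. *)
Lemma exactly_critical (a b m u v : R) :
  0 < m -> a + 1 / 3 + m <= b -> b <= a + 2 / 3 - m ->
  ~ linked u v a (a + 1 / 3) -> ~ linked u v b (b + 1 / 3) ->
  eq_mod1 v (u + 1 / 3) -> eq_mod1 u a \/ eq_mod1 u b.
Proof.
move=> m0 Hab Hba Na Nb E.
case: (classic (eq_mod1 u a)) => [|nEa]; first by left.
case: (classic (eq_mod1 u b)) => [|nEb]; first by right.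
have [d1 [p1 f1]] := not_eq_mod1_far nEa.
have [d2 [p2 f2]] := not_eq_mod1_far nEb.
pose d := Rmin (Rmin d1 d2) (Rmin m (1 / 9)).
have [A1 A2] : d <= Rmin d1 d2 /\ d <= Rmin m (1 / 9).
  by split; [apply: Rmin_l | apply: Rmin_r].
have := (Rmin_l d1 d2, Rmin_r d1 d2, Rmin_l m (1/9), Rmin_r m (1/9)).
move=> [[[B1 B2] B3] B4].
have d0 : 0 < d by rewrite /d; repeat apply: Rmin_glb_lt; lra.
have N : near_int d (v - u - 1 / 3).
  have -> : v - u - 1 / 3 = v - (u + 1 / 3) by lra.
  exact: eq_mod1_near.
have [] := nearly_critical Hab Hba d0 ltac:(lra) ltac:(lra) Na Nb N.
- by move=> H; case: f1; apply: near_int_mono H; lra.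
- by move=> H; case: f2; apply: near_int_mono H; lra.
Qed.

(** * Cluster points along conditions that tighten as a scale tends to 0 *)

Section Cluster.
Variables (T : Type) (P : R -> T -> Prop).
Hypothesis P_mono : forall d e t, d <= e -> P d t -> P e t.
Hypothesis P_ne : forall e, 0 < e -> exists t, P e t.

(** The point is the upper limit of f: the supremum of the levels that f reaches at every scale. *)
Lemma cluster_point (f : T -> R) : (forall t, 0 <= f t /\ f t <= 1) ->
  exists x, forall e, 0 < e -> exists t, P e t /\ Rabs (f t - x) < e.
Proof.
move=> f01.
pose E s := forall e, 0 < e -> exists t, P e t /\ s <= f t.
have bE : bound E.
  exists 1 => s Es; have [t [_ st]] := Es 1 Rlt_0_1; have := f01 t; lra.
have [x [ub lub]] : {x | is_lub E x}.
  apply: completeness => //; exists 0 => e /P_ne [t Pt].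
  by exists t; split=> //; case: (f01 t).
exists x => e e0.
have nE : ~ E (x + e) by move=> /ub; lra.
have [e1 [e10 H1]] : exists e1, 0 < e1 /\ forall t, P e1 t -> f t < x + e.
  apply: NNPP => H; apply: nE => e1 e10; apply: NNPP => H2; apply: H.
  exists e1; split=> // t Pt; apply: Rnot_le_lt => L; apply: H2.
  by exists t.
have [s [Es Hs]] : exists s, E s /\ x - e < s.
  apply: NNPP => H; have : x <= x - e; last by lra.
  apply: lub => s Es; apply: Rnot_lt_le => L; apply: H; by exists s.
have m0 : 0 < Rmin e e1 by apply: Rmin_glb_lt.
have [t [Pt st]] := Es _ m0; exists t; split.
  by apply: P_mono Pt; apply: Rmin_l.
have := H1 _ (P_mono (Rmin_r _ _) Pt).
by move=> L; apply: Rabs_def1; lra.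
Qed.

Lemma cluster_point_mod1 (f : T -> R) :
  exists x, forall e, 0 < e -> exists t, P e t /\ near_int e (f t - x).
Proof.
have f01 t : 0 <= frac_part (f t) /\ frac_part (f t) <= 1.
  by have := base_fp (f t); lra.
have [x Hx] := cluster_point f01; exists x => e /Hx [t [Pt /Rabs_def2 A]].
exists t; split=> //; exists (Int_part (f t)); move: A; rewrite /frac_part; lra.
Qed.

(** Pigeonhole: if each of the finitely many alternatives failed at some scale, all would fail at
    the smallest of these scales. *)
Lemma mono_pick (l : list (T -> Prop)) :
  (forall e, 0 < e -> exists C, List.In C l /\ exists t, P e t /\ C t) ->
  exists C, List.In C l /\ forall e, 0 < e -> exists t, P e t /\ C t.
Proof.
elim: l => [|C l IH] H; first by case: (H 1 Rlt_0_1) => ? [].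
case: (classic (forall e, 0 < e -> exists t, P e t /\ C t)) => [HC|].
  by exists C; split=> //; left.
move=> nC; have [e1 nC1] := not_all_ex_not _ _ nC.
have [e10 HC] := imply_to_and _ _ nC1.
suff /IH [C' [inC' HC']] : forall e, 0 < e ->
    exists C', List.In C' l /\ exists t, P e t /\ C' t.
  by exists C'; split=> //; right.
move=> e e0; have m0 : 0 < Rmin e e1 by apply: Rmin_glb_lt.
have [C' [[<-|inC'] [t [Pt Ct]]]] := H _ m0.
  by case: HC; exists t; split=> //; apply: P_mono Pt; apply: Rmin_r.
exists C'; split=> //; exists t; split=> //.
by apply: P_mono Pt; apply: Rmin_l.
Qed.

End Cluster.

(** * Orbits of wandering triangles and their limits *)

Inductive corner := C0 | C1 | C2.

(* The orbit of a triangle with vertices [t i] in a wandering class of a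
   lamination that has the critical chords {a, a + 1/3} and {b, b + 1/3}.  All
   points are real numbers read modulo 1. *)
Record wandering (a b : R) (t : corner -> R) : Prop := Wandering {
  wandering_distinct : forall n i j, i <> j -> ~ eq_mod1 (3 ^ n * t i) (3 ^ n * t j);
  wandering_apart : forall n m i j, n <> m -> ~ eq_mod1 (3 ^ n * t i) (3 ^ m * t j);
  wandering_unlinked : forall n m i j k l, n <> m ->
    ~ linked (3 ^ n * t i) (3 ^ n * t j) (3 ^ m * t k) (3 ^ m * t l);
  wandering_critical : forall n i j e, e = a \/ e = b ->
    ~ linked (3 ^ n * t i) (3 ^ n * t j) e (e + 1 / 3) }.

Lemma wandering_mul3 a b t n :
  wandering a b t -> wandering a b (fun i => 3 ^ n * t i).
Proof.
have E k i : 3 ^ k * (3 ^ n * t i) = 3 ^ (k + n) * t i.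
  by rewrite pow_add Rmult_assoc.
case=> H1 H2 H3 H4; split=> *; rewrite !E; auto.
- by apply: H2 => /addIn.
- by apply: H3 => /addIn.
Qed.

Lemma wandering_relabel a b t f : (forall i j : corner, f i = f j -> i = j) ->
  wandering a b t -> wandering a b (fun i => t (f i)).
Proof.
by move=> fI [H1 H2 H3 H4]; split=> *; auto; apply: H1 => /fI.
Qed.

(** The critical chords of the approximating triangles vary as well and only tend to those at a and
    b. Vertices of a limit may coincide. *)
Definition limit_triangle (a b : R) (t : corner -> R) : Prop :=
  forall e, 0 < e -> exists a' b' t', wandering a' b' t' /\
    near_int e (a' - a) /\ near_int e (b' - b) /\
    forall i, near_int e (t' i - t i).

Lemma near_int_div3 e n x : near_int (e / 3 ^ n) x -> near_int e (3 ^ n * x).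
Proof.
move=> /(@near_int_mul3 _ _ n); congr near_int; field.
by have := pow3_gt0 n; lra.
Qed.

Lemma div3_gt0 e n : 0 < e -> 0 < e / 3 ^ n.
Proof. by move=> e0; apply: Rdiv_lt_0_compat => //; apply: pow3_gt0. Qed.

Lemma div3_le e n : 0 < e -> e / 3 ^ n <= e.
Proof.
move=> e0; apply: (Rmult_le_reg_r (3 ^ n)); first exact: pow3_gt0.
have -> : e / 3 ^ n * 3 ^ n = e by field; have := pow3_gt0 n; lra.
have := Rmult_le_compat_l e _ _ (Rlt_le _ _ e0) (pow3_ge1 n); lra.
Qed.

Lemma limit_mul3 a b t n :
  limit_triangle a b t -> limit_triangle a b (fun i => 3 ^ n * t i).
Proof.
move=> L e e0; have [a' [b' [t' [W [Ha [Hb Ht]]]]]] := L _ (div3_gt0 n e0).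
exists a', b', (fun i => 3 ^ n * t' i); split; first exact: wandering_mul3.
split; first by apply: near_int_mono Ha; apply: div3_le.
split; first by apply: near_int_mono Hb; apply: div3_le.
by move=> i; rewrite -Rmult_minus_distr_l; apply: near_int_div3.
Qed.

Lemma limit_relabel a b t f : (forall i j : corner, f i = f j -> i = j) ->
  limit_triangle a b t -> limit_triangle a b (fun i => t (f i)).
Proof.
move=> fI L e e0; have [a' [b' [t' [W [Ha [Hb Ht]]]]]] := L _ e0.
exists a', b', (fun i => t' (f i)); split; last by split.
exact: (wandering_relabel fI W).
Qed.

Lemma limit_closed a b t :
  (forall e, 0 < e -> exists t', limit_triangle a b t' /\
     forall i, near_int e (t' i - t i)) -> limit_triangle a b t.
Proof.
move=> H e e0; have [t1 [L Ht]] := H (e / 2) ltac:(lra).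
have [a' [b' [t' [W [Ha [Hb Ht']]]]]] := L (e / 2) ltac:(lra).
exists a', b', t'; split=> //.
split; first by apply: near_int_mono Ha; lra.
split; first by apply: near_int_mono Hb; lra.
move=> i; have -> : e = e / 2 + e / 2 by lra.
by apply: near_int_add (Ht' i) (Ht i) _; lra.
Qed.

(** A crossing in the limit would already occur, by openness, between an approximating triangle and
    its own critical chord. *)
Lemma limit_critical a b t i j e : limit_triangle a b t -> e = a \/ e = b ->
  ~ linked (t i) (t j) e (e + 1 / 3).
Proof.
move=> L He /linked_open [d [d0 H]].
have [a' [b' [t' [W [Ha [Hb Ht]]]]]] := L d d0.
have [e' [He' Ne]] : exists e', (e' = a' \/ e' = b') /\ near_int d (e' - e).
  by case: He => ->; [exists a' | exists b']; split; auto.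
have := wandering_critical W (n := 0) (i := i) (j := j) He'.
rewrite /= !Rmult_1_l; apply; apply: H => //.
by have -> : e' + 1 / 3 - (e + 1 / 3) = e' - e by lra.
Qed.

(** * Orbits under multiplication, and pairs of close triangles *)

Lemma eventually_constant (f : nat -> Z) :
  (forall n, (0 <= f n)%Z) -> (forall n, (f (S n) <= f n)%Z) ->
  exists N, forall n, f (N + n)%N = f N.
Proof.
move=> f0 fS.
suff H v : forall N, (f N <= Z.of_nat v)%Z -> exists N, forall n, f (N + n)%N = f N.
  by apply: (H (Z.to_nat (f O)) O); have := f0 O; lia.
elim: v => [|v IH] N HN.
  exists N; elim=> [|n IHn]; first by rewrite addn0.
  by rewrite addnS; have := fS (N + n)%N; have := f0 (N + n).+1; have := f0 N; lia.
case: (classic (exists M, (f M <= Z.of_nat v)%Z)) => [[M /IH] //|nE].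
exists N; elim=> [|n IHn]; first by rewrite addn0.
rewrite addnS; have := fS (N + n)%N.
have : ~ (f (N + n).+1 <= Z.of_nat v)%Z by move=> L; apply: nE; exists (N + n).+1.
lia.
Qed.

(* Along a monotone orbit of x -> Q x mod 1 the integer parts stabilize, after
   which the increments are multiplied by Q at each step. *)
Lemma monotone_orbit_fixed (Q : R) (c : nat -> R) : 2 <= Q ->
  (forall n, 0 < c n /\ c n < 1) -> (forall n, eq_mod1 (Q * c n) (c (S n))) ->
  (forall n, c (S n) <= c n) -> exists n, c (S n) = c n.
Proof.
move=> Q2 c01 cS cle.
pose d n := Int_part (Q * c n).
have dE n : Q * c n - c (S n) = IZR (d n).
  have [k Hk] := cS n; rewrite Hk; congr IZR.
  have [h1 h2] := base_Int_part (Q * c n); have [h3 h4] := c01 (S n).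
  have A : IZR (d n) < IZR k + 1 by rewrite /d; lra.
  have B : IZR k < IZR (d n) + 1 by rewrite /d; lra.
  by move: (IZR_lt_succ A) (IZR_lt_succ B); lia.
have d0 n : (0 <= d n)%Z.
  apply: IZR_lt_succ; rewrite -dE; have := c01 (S n); have := c01 n.
  have := Rmult_le_compat_r (c n) 2 Q; lra.
have dle n : (d (S n) <= d n)%Z.
  apply: IZR_lt_succ; rewrite -!dE.
  have := Rmult_le_compat_l Q _ _ ltac:(lra) (cle n).
  have := c01 (S (S n)); have := c01 (S n); lra.
have [N dN] := eventually_constant d0 dle.
exists N; apply: Rle_antisym => //; apply: Rnot_lt_le => lt.
pose g n := c (N + n)%N - c (N + n).+1.
have gS n : g (S n) = Q * g n.
  rewrite /g addnS; have := dE (N + n)%N; have := dE (N + n).+1.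
  by rewrite -[(N + n).+1]addnS !dN; lra.
have gE n : g n = Q ^ n * g O by elim: n => [|n IH]; rewrite ?gS ?IH /=; ring.
have g0 : 0 < g O by rewrite /g addn0; lra.
have [n Hn] := INR_unbounded (/ g O).
(* [poly] is Bernoulli's inequality: [2 ^ n] exceeds n and hence [/ g 0], so the increment [g n]
   would be greater than 1. *)
have := poly n 1 Rlt_0_1; have := pow_incr 2 Q n ltac:(lra).
have -> : 1 + 1 = 2 by lra.
move=> P1 P2; have : g n < 1.
  by rewrite /g; have := c01 (N + n)%N; have := c01 (N + n).+1; lra.
have := Rmult_lt_compat_r _ _ _ g0 Hn; rewrite Rinv_l; last by lra.
rewrite (gE n) => h1 h2; have : Q ^ n * g O < INR n * g O by lra.
by move/Rmult_lt_reg_r => /(_ g0); lra.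
Qed.

(** Pulling back step by step, either the inverse branch fixing 0 is taken all the way to time 0, or
    h is the last time at which another branch is taken, r steps before the end. *)
Lemma near_int_backtrack n d x : near_int d (3 ^ n * x) ->
  near_int (d / 3 ^ n) x \/
  exists h r, n = (h + r)%N /\ (0 < r)%N /\
    (near_int (d / 3 ^ r) (3 ^ h * x - 1 / 3) \/
     near_int (d / 3 ^ r) (3 ^ h * x + 1 / 3)).
Proof.
elim: n d => [|n IH] d; first by rewrite /= Rmult_1_l Rdiv_1_r; left.
rewrite /= Rmult_assoc => /near_int_third [/IH|N].
  have E k : d / 3 / 3 ^ k = d / (3 * 3 ^ k).
    by field; have := pow3_gt0 k; lra.
  rewrite E; case; first by left.
  move=> [h [r [-> [r0 N]]]]; right; exists h, r.+1.
  by rewrite addnS /= -E.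
by right; exists n, 1%N; rewrite addn1 /= Rmult_1_r.
Qed.

Lemma cluster_triangle (T : Type) (P : R -> T -> Prop) :
  (forall d e t, d <= e -> P d t -> P e t) -> (forall e, 0 < e -> exists t, P e t) ->
  forall g : T -> corner -> R, exists x, forall e, 0 < e ->
    exists t, P e t /\ forall i, near_int e (g t i - x i).
Proof.
move=> P_mono P_ne g.
(* One corner at a time: the refined condition [S'] is again monotone and satisfiable, so it serves
   as [S] for the next corner. Stating it through an equation lets [erefl] determine it. *)
have step (S : R -> T -> Prop) i : (forall d e t, d <= e -> S d t -> S e t) ->
    (forall e, 0 < e -> exists t, S e t) -> exists x, forall S',
    S' = (fun e t => S e t /\ near_int e (g t i - x)) ->
    (forall d e t, d <= e -> S' d t -> S' e t) /\ (forall e, 0 < e -> exists t, S' e t).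
  move=> S_mono S_ne; have [x Hx] := cluster_point_mod1 S_mono S_ne (fun t => g t i).
  exists x => _ ->; split=> // d e t de [St Nt].
  by split; [apply: S_mono St | apply: near_int_mono Nt].
have [x0 /(_ _ erefl) [m0 n0]] := step P C0 P_mono P_ne.
have [x1 /(_ _ erefl) [m1 n1]] := step _ C1 m0 n0.
have [x2 /(_ _ erefl) [_ n2]] := step _ C2 m1 n1.
exists (fun i => match i with C0 => x0 | C1 => x1 | C2 => x2 end) => e /n2.
by move=> [t [[[Pt N0] N1] N2]]; exists t; split=> //; case.
Qed.

Lemma third_corner (i j : corner) : exists k, k <> i /\ k <> j.
Proof. by case: i; case: j; (exists C0 + exists C1 + exists C2). Qed.

(* Among the three displacements two have the same direction. *)
Lemma close_triangles_linked d (x y : corner -> R) :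
  (forall i j, i <> j -> ~ near_int d (x i - x j)) ->
  (forall i j, i <> j -> ~ near_int d (y i - y j)) ->
  (forall i, near_int d (y i - x i)) -> (forall i, ~ eq_mod1 (x i) (y i)) ->
  exists i j, linked (x i) (x j) (y i) (y j).
Proof.
move=> fx fy near ne.
pose pos i := exists s, 0 < s /\ s < d /\ eq_mod1 (y i) (x i + s).
pose neg i := exists s, 0 < s /\ s < d /\ eq_mod1 (x i) (y i + s).
have side i : pos i \/ neg i.
  have [k Hk] := near i; case: (Rtotal_order (y i - x i) (IZR k)) => [lt|[eq|gt]].
  - right; exists (IZR k - (y i - x i)); split; first lra; split; first lra.
    by exists (Z.opp k); pushZ; lra.
  - by case: (ne i); exists (Z.opp k); pushZ; lra.
  - left; exists (y i - x i - IZR k); split; first lra; split; first lra.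
    by exists k; lra.
have pp i j : i <> j -> pos i -> pos j -> linked (x i) (x j) (y i) (y j).
  by move=> ij; apply: linked_parallel; apply: fx.
have nn i j : i <> j -> neg i -> neg j -> linked (x i) (x j) (y i) (y j).
  by move=> ij ni nj; apply: linked_sym; apply: linked_parallel ni nj; apply: fy.
case: (side C0) => h0; case: (side C1) => h1; case: (side C2) => h2;
  first [exists C0, C1; solve [by apply: pp | by apply: nn]
       | exists C0, C2; solve [by apply: pp | by apply: nn]
       | exists C1, C2; solve [by apply: pp | by apply: nn]].
Qed.

(** * No nondegenerate limit triangles at preperiodic, non-recurrent critical chords *)

Section Core.

(** Here [m] is a margin between the two critical chords, [D] a radius of non-recurrence, [K] a time
    at which the critical points have reached [p], and [q] a period of [p]. *)
Variables (a b m D p : R) (K q : nat).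
Hypothesis m_gt0 : 0 < m.
Hypothesis D_gt0 : 0 < D.
Hypothesis K_gt0 : (0 < K)%N.
Hypothesis q_gt0 : (0 < q)%N.
Hypothesis ab_lb : a + 1 / 3 + m <= b.
Hypothesis ab_ub : b <= a + 2 / 3 - m.

Local Notation crit e := (e = a \/ e = b).
Local Notation limit t := (limit_triangle a b t).

Hypothesis orbit_far : forall n c e, (0 < n)%N -> crit c -> crit e ->
  ~ near_int D (3 ^ n * c - e) /\ ~ near_int D (3 ^ n * c - (e + 1 / 3)).
Hypothesis orbit_p : forall c, crit c -> eq_mod1 (3 ^ K * c) p.
Hypothesis p_fixed : eq_mod1 (3 ^ q * p) p.
Hypothesis no_fixed_leaf : forall w, eq_mod1 (3 ^ q * w) w -> ~ eq_mod1 w p ->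
  (forall n e, crit e -> ~ linked (3 ^ n * p) (3 ^ n * w) e (e + 1 / 3)) -> False.

Lemma critical_third c e : crit c -> crit e -> ~ eq_mod1 c (e + 1 / 3).
Proof.
move=> Hc He [k Hk].
have A : IZR k < IZR 0 + 1 by case: Hc He Hk => -> [] ->; lra.
have B : IZR (-1) < IZR k + 1 by case: Hc He Hk => -> [] ->; lra.
move: (IZR_lt_succ A) (IZR_lt_succ B) => A' B'.
have : (k = 0 \/ k = -1)%Z by lia.
by case=> E; rewrite E in Hk; case: Hc He Hk => -> [] ->; lra.
Qed.

(** One vertex tends to [p] strictly from the side given by the sign [s], while another tends to z.
    The side is recorded because [q] triplings preserve it and push the vertex away from [p]. *)
Definition side_limit (s z : R) : Prop := forall e, 0 < e ->
  exists a' b' t i k r, wandering a' b' t /\ 0 < r /\ r < e /\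
    eq_mod1 (t i) (p + s * r) /\ near_int e (t k - z).

Lemma side_limit_mul3 s z : side_limit s z -> side_limit s (3 ^ q * z).
Proof.
move=> H e e0; have [a' [b' [t [i [k [r [W [r0 [re [Hi Hk]]]]]]]]]] := H _ (div3_gt0 q e0).
exists a', b', (fun i => 3 ^ q * t i), i, k, (3 ^ q * r).
split; first exact: wandering_mul3.
have q0 := pow3_gt0 q.
split; first by apply: Rmult_lt_0_compat.
split.
  have -> : e = 3 ^ q * (e / 3 ^ q) by field; lra.
  exact: Rmult_lt_compat_l.
split; last by rewrite -Rmult_minus_distr_l; apply: near_int_div3.
apply: eq_mod1_trans (eq_mod1_mul3 q Hi) _.
by have [l Hl] := p_fixed; exists l; rewrite -Hl; ring.
Qed.

Lemma pow3q_ge3 : 3 <= 3 ^ q.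
Proof. by case: q q_gt0 => // n _ /=; have := pow3_ge1 n; lra. Qed.

Lemma eq_mod1_sign s x y : s = 1 \/ s = -1 -> eq_mod1 x y -> eq_mod1 (s * x) (s * y).
Proof.
by move=> [->|->] [k Hk]; [exists k | exists (Z.opp k); pushZ]; lra.
Qed.

(* Otherwise the chord from the short side to z would cross its image. *)
Lemma side_limit_le s z c c' : s = 1 \/ s = -1 -> side_limit s z ->
  0 < c -> c' < 1 -> eq_mod1 (s * (z - p)) c -> eq_mod1 (s * (3 ^ q * z - p)) c' ->
  c' <= c.
Proof.
move=> Hs H c0 c1 [k1 E1] [k2 E2]; apply: Rnot_lt_le => lt.
have Q3 := pow3q_ge3; set Q := 3 ^ q in Q3 E2 *.
pose e := Rmin c (Rmin (c' - c) (1 - c')) / 4.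
have [e0 [e1 [e2 e3]]] : 0 < e /\ 4 * e <= c /\ 4 * e <= c' - c /\ 4 * e <= 1 - c'.
  have := (Rmin_l c (Rmin (c' - c) (1 - c')), Rmin_r c (Rmin (c' - c) (1 - c')),
    Rmin_l (c' - c) (1 - c'), Rmin_r (c' - c) (1 - c')) => -[[[A1 A2] A3] A4].
  have : 0 < Rmin c (Rmin (c' - c) (1 - c')) by repeat apply: Rmin_glb_lt; lra.
  by rewrite /e; lra.
have [a' [b' [t [i [k [r [W [r0 [re [[k3 Hi] [k4 Hk]]]]]]]]]]] := H _ (div3_gt0 q e0).
rewrite -/Q in re Hk.
have Qr : Q * r < e.
  have -> : e = Q * (e / Q) by field; lra.
  by apply: Rmult_lt_compat_l; lra.
have eQ : e / Q <= e by apply: div3_le.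
pose h := t k - z - IZR k4.
have [h1 h2] : - e < Q * h /\ Q * h < e.
  have E : e = Q * (e / Q) by field; lra.
  rewrite {1 2}E; split; last by apply: Rmult_lt_compat_l; rewrite /h; lra.
  have -> : - (Q * (e / Q)) = Q * (- (e / Q)) by ring.
  by apply: Rmult_lt_compat_l; rewrite /h; lra.
have := wandering_unlinked W (n := 0) (m := q) (i := i) (j := k) (k := i) (l := k).
rewrite /= !Rmult_1_l -/Q; apply; first by move: q_gt0; case: (q).
have lin x y u v : linked (s * x) (s * y) (s * u) (s * v) -> linked x y u v.
  case: Hs => ->; first by rewrite !Rmult_1_l.
  have M w : -1 * w = - w by ring.
  by rewrite !M; apply: linked_opp.
have ss : s * s = 1 by case: Hs => ->; lra.
apply: lin.
have [QZ HQ] := pow3_IZR q; rewrite -/Q in HQ.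
have I1 : eq_mod1 (s * t i) (s * p + r).
  have -> : s * p + r = s * (p + s * r) by rewrite Rmult_plus_distr_l -Rmult_assoc ss; ring.
  by apply: eq_mod1_sign => //; exists k3.
have I2 : eq_mod1 (s * (Q * t i)) (s * p + Q * r).
  have -> : s * p + Q * r = s * (p + s * (Q * r)).
    by rewrite Rmult_plus_distr_l -Rmult_assoc ss; ring.
  apply: eq_mod1_sign => //; have [l Hl] := p_fixed; rewrite -/Q in Hl.
  exists (Z.add (Z.mul QZ k3) l); pushZ; rewrite HQ -Hi -Hl; ring.
have I3 : eq_mod1 (s * t k) (s * p + c + s * h).
  case: Hs => Es; rewrite /h Es in E1 *.
    by exists (Z.add k4 k1); pushZ; lra.
  by exists (Z.sub k1 k4); pushZ; lra.
have I4 : eq_mod1 (s * (Q * t k)) (s * p + c' + s * (Q * h)).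
  have -> : Q * h = Q * t k - Q * z - IZR (Z.mul QZ k4) by rewrite /h; pushZ; rewrite HQ; ring.
  case: Hs => Es; rewrite Es in E2 *.
    by exists (Z.add (Z.mul QZ k4) k2); rewrite plus_IZR; lra.
  by exists (Z.sub k2 (Z.mul QZ k4)); rewrite minus_IZR; lra.
apply: linked_eq_mod1 I1 I3 I2 I4 _.
(* Measured from p in direction s, the four points are r, [Q * r], about c and about c', in this
   order; the choice of e makes the errors too small to disturb it. *)
left; exists Z0, Z0, Z0.
have : r < Q * r by have := Rmult_lt_compat_r r 1 Q r0; lra.
have : - e < h /\ h < e by rewrite /h; lra.
by case: Hs => ->; lra.
Qed.

(** After [K] triplings the critical side has collapsed to [p] but the third vertex has not. Its
    further images under [3 ^ q] form a monotone orbit, which stops at a periodic partner of [p]. *)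
Lemma no_critical_limit t e i j k : limit t -> crit e -> i <> j ->
  eq_mod1 (t i) e -> eq_mod1 (t j) (e + 1 / 3) ->
  ~ eq_mod1 (t k) e -> ~ eq_mod1 (t k) (e + 1 / 3) -> False.
Proof.
move=> L He ij Ei Ej nk nk'.
(* Just before the orbits of [t k] and [e] would merge, their images differ by 1/3, so
   [exactly_critical] makes the image of [e] an endpoint of a critical chord. By [orbit_far] this
   can only be at time 0, where the hypotheses on [t k] and the separation of the chords exclude
   it. *)
have collapse n : ~ eq_mod1 (3 ^ n * t k) (3 ^ n * e).
  elim: n => [|n IH]; first by rewrite /= !Rmult_1_l.
  rewrite /= !Rmult_assoc => /eq_mod1_third [//|H].
  have Ln := limit_mul3 n L.
  have Ein := eq_mod1_mul3 n Ei.
  have crit_near c : crit c -> eq_mod1 (3 ^ n * e) c -> n = O.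
    move=> Hc E; case: (posnP n) => // n0.
    by case: (proj1 (orbit_far n0 He Hc)); apply: eq_mod1_near.
  case: H => H.
    have : exists c, crit c /\ eq_mod1 (3 ^ n * t i) c.
      have H' : eq_mod1 (3 ^ n * t k) (3 ^ n * t i + 1 / 3).
        apply: eq_mod1_trans H _; have [l Hl] := Ein; exists (Z.opp l); pushZ; lra.
      case: (exactly_critical m_gt0 ab_lb ab_ub _ _ H').
      - by apply: (limit_critical (i := i) (j := k) Ln); left.
      - by apply: (limit_critical (i := i) (j := k) Ln); right.
      - by move=> E; exists a; split; [left|].
      - by move=> E; exists b; split; [right|].
    move=> [c [Hc E]].
    have n0 := crit_near c Hc (eq_mod1_trans (eq_mod1_sym Ein) E).
    by move: H; rewrite n0 /= !Rmult_1_l.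
  have : exists c, crit c /\ eq_mod1 (3 ^ n * t k) c.
    have H' : eq_mod1 (3 ^ n * t i) (3 ^ n * t k + 1 / 3) by apply: eq_mod1_trans H.
    case: (exactly_critical m_gt0 ab_lb ab_ub _ _ H').
    - by apply: (limit_critical (i := k) (j := i) Ln); left.
    - by apply: (limit_critical (i := k) (j := i) Ln); right.
    - by move=> E; exists a; split; [left|].
    - by move=> E; exists b; split; [right|].
  move=> [c [Hc E]].
  have E' : eq_mod1 (3 ^ n * e) (c + 1 / 3).
    by apply: eq_mod1_trans H _; have [l Hl] := E; exists l; lra.
  case: (posnP n) => [n0|n0].
    by move: E'; rewrite n0 /= Rmult_1_l; apply: critical_third.
  by case: (proj2 (orbit_far n0 He Hc)); apply: eq_mod1_near.
pose z0 := 3 ^ K * t k.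
have LK := limit_mul3 K L.
have KE : eq_mod1 (3 ^ K * e) p := orbit_p He.
have EiK : eq_mod1 (3 ^ K * t i) p by apply: eq_mod1_trans (eq_mod1_mul3 K Ei) KE.
have EjK : eq_mod1 (3 ^ K * t j) p.
  apply: eq_mod1_trans (eq_mod1_mul3 K Ej) _.
  move: K_gt0 KE; case: (K) => // n _ [l Hl].
  have [x Hx] := pow3_IZR n.
  by exists (Z.add l x); pushZ; rewrite Hx -Hl /=; field.
(* The distinct vertices [t' i] and [t' j] both tend to p, so one of them is close to p without
   being p. Pigeonhole then selects one side that occurs at every scale. *)
have [s [Hs Hside]] : exists s, (s = 1 \/ s = -1) /\ side_limit s z0.
  pose T := (R * (R * (R * (corner -> R) * corner * R)))%type.
  pose P (d : R) (x : T) := let: (s, (a', (b', t', l, r))) := x in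
    wandering a' b' t' /\ 0 < r /\ r < d /\ eq_mod1 (t' l) (p + s * r) /\
    near_int d (t' k - z0).
  have Pmono d d' x : d <= d' -> P d x -> P d' x.
    case: x => [s [a' [[[b' t'] l] r]]] dd' [W [r0 [rd [E N]]]].
    split=> //; split=> //; split; first lra.
    by split=> //; apply: near_int_mono N.
  pose S1 (x : T) := x.1 = 1; pose S2 (x : T) := x.1 = -1.
  case: (@mono_pick T P Pmono [:: S1; S2]) => [d d0|C [HC H]]; last first.
    have {}HC : C = S1 \/ C = S2 by case: HC => [->|[->|[]]]; auto.
    have [s [Hs HC']] : exists s, (s = 1 \/ s = -1) /\ forall x, C x -> x.1 = s.
      by case: HC => ->; [exists 1 | exists (-1)]; split; auto.
    exists s; split=> // d d0; have [x [Px /HC' Cx]] := H d d0.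
    case: x Px Cx => [s' [a' [[[b' t'] l] r]]] /= Px Es.
    by exists a', b', t', l, k, r; rewrite -Es.
  have [a' [b' [t' [W [Ha [Hb Ht]]]]]] := LK d d0.
  have [l [El Nl]] : exists l, ~ eq_mod1 (t' l) p /\ near_int d (t' l - p).
    case: (classic (eq_mod1 (t' i) p)) => [Ei'|]; last first.
      move=> N; exists i; split=> //; apply: near_int_eq_mod1 (Ht i).
      by have [x Hx] := EiK; exists (Z.opp x); pushZ; lra.
    exists j; split.
      move=> Ej'; apply: (wandering_distinct W (n := 0) ij).
      by rewrite /= !Rmult_1_l; apply: eq_mod1_trans Ei' (eq_mod1_sym Ej').
    apply: near_int_eq_mod1 (Ht j).
    by have [x Hx] := EjK; exists (Z.opp x); pushZ; lra.
  have [x Hx] := Nl.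
  case: (Rtotal_order (t' l - p) (IZR x)) => [lt|[eq|gt]].
  - exists S2; split; first by right; left.
    exists (-1, (a', (b', t', l, p + IZR x - t' l))); split=> //.
    split=> //; split; first lra; split; first lra; split; last exact: Ht.
    by exists x; lra.
  - by case: El; exists x.
  - exists S1; split; first by left.
    exists (1, (a', (b', t', l, t' l - p - IZR x))); split=> //.
    split=> //; split; first lra; split; first lra; split; last exact: Ht.
    by exists x; lra.
(* The number [c n] below is the position of [z n] counted from p in direction s. It never
   increases, by [side_limit_le], and is never 0, by [collapse]. *)
pose z n := 3 ^ (q * n) * z0.
have zS n : z (S n) = 3 ^ q * z n by rewrite /z mulnS pow_add Rmult_assoc.
have pfix n : eq_mod1 (3 ^ (q * n) * p) p.
  elim: n => [|n IH]; first by rewrite muln0 /= Rmult_1_l; apply: eq_mod1_refl.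
  rewrite mulnS pow_add Rmult_assoc.
  exact: eq_mod1_trans (eq_mod1_mul3 q IH) p_fixed.
have z_ne n : ~ eq_mod1 (z n) p.
  move=> E; apply: (collapse (q * n + K)%N).
  rewrite pow_add !Rmult_assoc; apply: eq_mod1_trans E _; apply: eq_mod1_sym.
  exact: eq_mod1_trans (eq_mod1_mul3 _ KE) (pfix n).
have z_side n : side_limit s (z n).
  elim: n => [|n IH]; first by rewrite /z muln0 /= Rmult_1_l.
  by rewrite zS; apply: side_limit_mul3.
pose c n := frac_part (s * (z n - p)).
have cE n : eq_mod1 (s * (z n - p)) (c n).
  by exists (Int_part (s * (z n - p))); rewrite /c /frac_part; ring.
have c01 n : 0 < c n /\ c n < 1.
  have [h1 h2] := base_fp (s * (z n - p)); split; last exact: h2.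
  suff : c n <> 0 by rewrite /c; lra.
  move=> c0; apply: (z_ne n); have := cE n; rewrite c0 => /(eq_mod1_sign Hs).
  have ss : s * s = 1 by case: Hs => ->; lra.
  by rewrite -Rmult_assoc ss Rmult_0_r => -[x Hx]; exists x; lra.
have cS n : eq_mod1 (3 ^ q * c n) (c (S n)).
  apply: eq_mod1_trans (eq_mod1_mul3 q (eq_mod1_sym (cE n))) _.
  apply: eq_mod1_trans (cE (S n)); rewrite zS.
  have -> : 3 ^ q * (s * (z n - p)) = s * (3 ^ q * z n - 3 ^ q * p) by ring.
  apply: eq_mod1_sign => //; have [x Hx] := p_fixed.
  by exists (Z.opp x); pushZ; lra.
have cle n : c (S n) <= c n.
  have [h1 h2] := c01 n; have [h3 h4] := c01 (S n).
  by apply: (side_limit_le Hs (z_side n) h1 h4 (cE n)); rewrite -zS.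
have Q2 : 2 <= 3 ^ q by have := pow3q_ge3; lra.
have [N EN] := monotone_orbit_fixed Q2 c01 cS cle.
apply: (no_fixed_leaf (w := z N)) => [||n f Hf].
- rewrite -zS; have := cE (S N); rewrite EN => h.
  have ss : s * s = 1 by case: Hs => ->; lra.
  have := eq_mod1_sign Hs (eq_mod1_trans h (eq_mod1_sym (cE N))).
  by rewrite -!Rmult_assoc ss => -[x Hx]; exists x; lra.
- exact: z_ne.
(* The chord {p, z N} is an image of the side {t i, t k}, so its iterates cross no critical
   chord. *)
- have LN := limit_mul3 n (limit_mul3 (q * N) LK).
  have := limit_critical (i := i) (j := k) LN Hf; move=> N1 N2; apply: N1.
  apply: linked_eq_mod1 N2; try exact: eq_mod1_refl.
  apply: eq_mod1_mul3; apply: eq_mod1_trans (pfix N).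
  exact: eq_mod1_mul3.
Qed.

Definition nondegenerate (t : corner -> R) : Prop :=
  forall i j, i <> j -> ~ eq_mod1 (t i) (t j).

(** If all sides stayed long, compactness would give two images so close to each other that
    [close_triangles_linked] makes them cross. *)
Lemma limit_short_sides t e : limit t -> nondegenerate t -> 0 < e ->
  exists n i j, i <> j /\ near_int e (3 ^ n * t i - 3 ^ n * t j).
Proof.
move=> L nd e0; apply: NNPP => none.
have far n i j : i <> j -> ~ near_int e (3 ^ n * t i - 3 ^ n * t j).
  by move=> ij N; apply: none; exists n, i, j.
(* As d tends to 0 this says that n tends to infinity; the second time r is later taken at a scale
   below [/ (INR n + 1)], which makes it differ from n. *)
pose P (d : R) (n : nat) := 0 < d /\ / d < INR n.
have Pmono d d' n : d <= d' -> P d n -> P d' n.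
  move=> dd' [d0 Hd]; split; first lra.
  by apply: Rle_lt_trans Hd; apply: Rinv_le_contravar.
have Pne d : 0 < d -> exists n, P d n.
  by move=> d0; have [n Hn] := INR_unbounded (/ d); exists n.
have [x Hx] := cluster_triangle Pmono Pne (fun n i => 3 ^ n * t i).
have e8 : 0 < e / 8 by lra.
have [n [_ N0]] := Hx _ e8.
have d0 : 0 < Rmin (e / 8) (/ (INR n + 1)).
  by apply: Rmin_glb_lt => //; apply: Rinv_0_lt_compat; have := pos_INR n; lra.
have [r [[d0' R] R0]] := Hx _ d0.
have dl := Rmin_l (e / 8) (/ (INR n + 1)); have dr := Rmin_r (e / 8) (/ (INR n + 1)).
have nr : n <> r.
  move=> E; have := Rinv_le_contravar _ _ d0 dr; rewrite Rinv_inv.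
  by move: R; rewrite -E; lra.
have close i : near_int (e / 4) (3 ^ r * t i - 3 ^ n * t i).
  apply: near_int_mono (near_int_add (R0 i) (near_int_sym (N0 i)) _); first lra.
  by ring.
(* Only genuine wandering triangles have disjoint images, so t is replaced by one whose images at
   times n and r are within e / 8 of those of t. *)
have d1 : 0 < Rmin (e / 8 / 3 ^ n) (e / 8 / 3 ^ r).
  by apply: Rmin_glb_lt; apply: div3_gt0.
have [a' [b' [t' [W [_ [_ Ht]]]]]] := L _ d1.
have Hn i : near_int (e / 8) (3 ^ n * t' i - 3 ^ n * t i).
  rewrite -Rmult_minus_distr_l; apply: near_int_div3.
  by apply: near_int_mono (Ht i); apply: Rmin_l.
have Hr i : near_int (e / 8) (3 ^ r * t' i - 3 ^ r * t i).
  rewrite -Rmult_minus_distr_l; apply: near_int_div3.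
  by apply: near_int_mono (Ht i); apply: Rmin_r.
have far' k : (forall i, near_int (e / 8) (3 ^ k * t' i - 3 ^ k * t i)) ->
    forall i j, i <> j -> ~ near_int (e / 2) (3 ^ k * t' i - 3 ^ k * t' j).
  move=> Hk i j ij N; apply: (far k i j ij).
  have A := near_int_add N (near_int_sym (Hk i)) erefl.
  have B := near_int_add A (Hk j) erefl.
  apply: (@near_int_mono (e / 2 + e / 8 + e / 8)); first lra.
  by move: B; congr near_int; ring.
have [||i|i|i [j]] := @close_triangles_linked (e / 2) (fun i => 3 ^ n * t' i)
  (fun i => 3 ^ r * t' i).
- exact: far'.
- exact: far'.
- have A := near_int_add (close i) (near_int_sym (Hn i)) erefl.
  have B := near_int_add A (Hr i) erefl.
  apply: (@near_int_mono (e / 4 + e / 8 + e / 8)); first lra.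
  by move: B; congr near_int; ring.
- exact: (wandering_apart W nr).
- exact: (wandering_unlinked W nr).
Qed.

(* A short side was created by an earlier passage near a critical chord, hence
   it follows the orbit of that chord, which never comes back near a critical
   chord. *)
Lemma no_short_side_near_critical t n r i k e f : limit t ->
  0 < r -> r <= m -> r <= 1 / 9 -> 2 * r <= D -> crit e -> f = e \/ f = e + 1 / 3 ->
  ~ near_int r (t k - t i) ->
  near_int (r / 2) (3 ^ n * t i - f) -> near_int (r / 2) (3 ^ n * t k - f) -> False.
Proof.
move=> L r0 rm r9 rD He Hf far Ni Nk.
have N : near_int r (3 ^ n * (t k - t i)).
  have -> : r = r / 2 + r / 2 by lra.
  by apply: near_int_add Nk (near_int_sym Ni) _; ring.
case: (near_int_backtrack N) => [N0|[h [s [En [s0 Hs]]]]].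
  by apply: far; apply: near_int_mono N0; apply: div3_le.
have d0 : 0 < r / 3 ^ s by apply: div3_gt0.
have dr : r / 3 ^ s <= r by apply: div3_le.
have Lh := limit_mul3 h L.
have no u v : near_int (r / 2) (3 ^ n * t u - f) ->
    near_int (r / 3 ^ s) (3 ^ h * t v - 3 ^ h * t u - 1 / 3) -> False.
  move=> Nu Nv.
  have Na := limit_critical (i := u) (j := v) Lh (or_introl erefl).
  have Nb := limit_critical (i := u) (j := v) Lh (or_intror erefl).
  have [c [Hc Nc]] : exists c, crit c /\ near_int (r / 3 ^ s) (3 ^ h * t u - c).
    have [] := nearly_critical ab_lb ab_ub d0 ltac:(lra) ltac:(lra) Na Nb Nv.
    - by exists a; split; [left|].
    - by exists b; split; [right|].
  have A : near_int r (3 ^ n * t u - 3 ^ s * c).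
    have := near_int_div3 Nc; congr near_int.
    by rewrite En pow_add; ring.
  have B : near_int D (3 ^ s * c - f).
    apply: (@near_int_mono (r + r / 2)); first lra.
    by apply: near_int_add (near_int_sym A) Nu _; ring.
  have [F1 F2] := orbit_far s0 Hc He.
  by case: Hf => Ef; rewrite Ef in B.
case: Hs => Hs.
- by apply: (no i k Ni); move: Hs; congr near_int; ring.
- apply: (no k i Nk); move/near_int_opp: Hs; congr near_int; ring.
Qed.

(** Just before a side first becomes shorter than a given e, its length is within e / 3 of 1/3, so
    it is near a critical chord. The bound [mu] is chosen before [d], so it survives as [d] tends to
    0. *)
Lemma near_critical_limits t : limit t -> nondegenerate t ->
  exists mu, 0 < mu /\ forall d, 0 < d -> exists t' e, limit t' /\ crit e /\
    near_int d (t' C0 - e) /\ near_int d (t' C1 - (e + 1 / 3)) /\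
    ~ near_int mu (t' C2 - e) /\ ~ near_int mu (t' C2 - (e + 1 / 3)).
Proof.
move=> L nd.
have [d01 [p01 f01]] := not_eq_mod1_far (nd C0 C1 ltac:(done)).
have [d02 [p02 f02]] := not_eq_mod1_far (nd C0 C2 ltac:(done)).
have [d12 [p12 f12]] := not_eq_mod1_far (nd C1 C2 ltac:(done)).
(* A lower bound for the sides of t that also satisfies the smallness conditions of
   [no_short_side_near_critical]. *)
pose r := Rmin (Rmin d01 (Rmin d02 d12)) (Rmin m (Rmin (1 / 9) (D / 2))).
have [A1 A2] : r <= Rmin d01 (Rmin d02 d12) /\ r <= Rmin m (Rmin (1 / 9) (D / 2)).
  by split; [apply: Rmin_l | apply: Rmin_r].
have := (Rmin_l d01 (Rmin d02 d12), Rmin_r d01 (Rmin d02 d12), Rmin_l d02 d12, Rmin_r d02 d12).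
move=> [[[B1 B2] B3] B4].
have := (Rmin_l m (Rmin (1/9) (D/2)), Rmin_r m (Rmin (1/9) (D/2)), Rmin_l (1/9) (D/2), Rmin_r (1/9) (D/2)).
move=> [[[B5 B6] B7] B8].
have r0 : 0 < r by rewrite /r; repeat apply: Rmin_glb_lt; lra.
have far i j : i <> j -> ~ near_int r (t i - t j).
  case: i; case: j => // _ N;
    first [ apply: f01; apply: near_int_mono N; lra
          | apply: f02; apply: near_int_mono N; lra
          | apply: f12; apply: near_int_mono N; lra
          | apply: f01; apply: near_int_mono (near_int_sym N); lra
          | apply: f02; apply: near_int_mono (near_int_sym N); lra
          | apply: f12; apply: near_int_mono (near_int_sym N); lra ].
exists (r / 2); split; first lra.
move=> d d0; pose e := Rmin d (r / 2).
have e0 : 0 < e by apply: Rmin_glb_lt; lra.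
have [ed er] : e <= d /\ e <= r / 2 by split; [apply: Rmin_l | apply: Rmin_r].
pose short n := exists i j, i <> j /\ near_int e (3 ^ n * t i - 3 ^ n * t j).
have [n [sn nsn]] : exists n, short (S n) /\ ~ short n.
  have [N HN] : exists N, short N.
    by have [N [i [j H]]] := limit_short_sides L nd e0; exists N, i, j.
  elim: N HN => [|N IH] HN.
    have [i [j [ij]]] := HN; rewrite /= !Rmult_1_l => H.
    by case: (far i j ij); apply: near_int_mono H; lra.
  by case: (classic (short N)) => [/IH //|nN]; exists N.
have Ln := limit_mul3 n L.
have [i [j [ij Nij]]] : exists i j, i <> j /\
    near_int (e / 3) (3 ^ n * t j - 3 ^ n * t i - 1 / 3).
  have [i [j [ij]]] := sn; rewrite /= !Rmult_assoc -Rmult_minus_distr_l.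
  case/near_int_third => [N|[N|N]].
  - by case: nsn; exists i, j; split=> //; apply: near_int_mono N; lra.
  - by exists j, i; split=> // E; apply: ij.
  - exists i, j; split=> //; move/near_int_opp: N; congr near_int; ring.
have Na := limit_critical (i := i) (j := j) Ln (or_introl erefl).
have Nb := limit_critical (i := i) (j := j) Ln (or_intror erefl).
have e3 : 0 < e / 3 by lra.
have [c [Hc Nc]] : exists c, crit c /\ near_int (e / 3) (3 ^ n * t i - c).
  have [] := nearly_critical ab_lb ab_ub e3 ltac:(lra) ltac:(lra) Na Nb Nij.
  - by exists a; split; [left|].
  - by exists b; split; [right|].
have Nc' : near_int (e / 3 + e / 3) (3 ^ n * t j - (c + 1 / 3)).
  by apply: near_int_add Nij Nc _; ring.
have [k [ki kj]] := third_corner i j.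
pose g l := match l with C0 => i | C1 => j | C2 => k end.
have gI l l' : g l = g l' -> l = l'.
  by case: l; case: l' => //= E; first [by case: ij | by case: ki | by case: kj].
exists (fun l => 3 ^ n * t (g l)), c; split; first exact: (limit_relabel gI Ln).
split=> //; split; first by apply: near_int_mono Nc; lra.
split; first by apply: near_int_mono Nc'; lra.
split=> /= N.
- apply: (no_short_side_near_critical L r0 _ _ _ Hc (or_introl erefl) (far k i ki) _ N); try lra.
  by apply: near_int_mono Nc; lra.
- apply: (no_short_side_near_critical L r0 _ _ _ Hc (or_intror erefl) (far k j kj) _ N); try lra.
  by apply: near_int_mono Nc'; lra.
Qed.

(** The triangles of [near_critical_limits] may approach either chord; [mono_pick] fixes one of
    them, and a cluster point of the third vertex completes a limit triangle with a critical side,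
    against [no_critical_limit]. *)
Lemma no_limit_triangle t : limit t -> nondegenerate t -> False.
Proof.
move=> L nd; have [mu [mu0 H]] := near_critical_limits L nd.
pose P e (d : R) t' := limit t' /\
    near_int d (t' C0 - e) /\ near_int d (t' C1 - (e + 1 / 3)) /\
    ~ near_int mu (t' C2 - e) /\ ~ near_int mu (t' C2 - (e + 1 / 3)).
have Pmono e d d' t' : d <= d' -> P e d t' -> P e d' t'.
  move=> dd' [L' [N0 [N1 F]]]; split=> //.
  by split; [apply: near_int_mono N0 | split=> //; apply: near_int_mono N1].
have [e [He Pe]] : exists e, crit e /\ forall d, 0 < d -> exists t', P e d t'.
  have mono (d d' : R) (x : R * (corner -> R)) : d <= d' -> P x.1 d x.2 -> P x.1 d' x.2.
    exact: Pmono.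
  have [|C [HC HP]] := mono_pick mono (l := [:: (fun x => x.1 = a); (fun x => x.1 = b)]).
    move=> d d0; have [t' [e [L' [He F]]]] := H d d0.
    by case: He => He; [exists (fun x => x.1 = a) | exists (fun x => x.1 = b)];
      (split; first by [left | right; left]); exists (e, t').
  case: HC => [E|[E|[]]]; rewrite -{}E in HP.
  - by exists a; split=> [|d /HP [[e t'] /= [Pt <-]]]; [left | exists t'].
  - by exists b; split=> [|d /HP [[e t'] /= [Pt <-]]]; [right | exists t'].
have [x Hx] := cluster_point_mod1 (Pmono e) Pe (fun t' => t' C2).
pose t0 l := match l with C0 => e | C1 => e + 1 / 3 | C2 => x end.
have Lt0 : limit t0.
  apply: limit_closed => d /Hx [t' [[L' [N0 [N1 _]]] N2]].
  by exists t'; split=> //; case.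
have far f : f = e \/ f = e + 1 / 3 -> ~ eq_mod1 x f.
  move=> Hf [k Hk]; have [t' [[_ [_ [_ [F F']]]] [l N]]] := Hx mu mu0.
  have N' : near_int mu (t' C2 - f) by exists (Z.add k l); pushZ; lra.
  by case: Hf => E; rewrite E in N'.
apply: (no_critical_limit (i := C0) (j := C1) (k := C2) Lt0 He) => //=.
- exact: eq_mod1_refl.
- exact: eq_mod1_refl.
- by apply: far; left.
- by apply: far; right.
Qed.

End Core.

(** * A dense supply of parameters without limit triangles *)

(** These points reach r / 8 modulo 1 after K triplings. The multiple 24, rather than 8, keeps the
    numerator congruent to r modulo 3. *)
Definition grid (K : nat) (r M : Z) : R := (24 * IZR M + IZR r) / (8 * 3 ^ K).

Lemma grid_dense (r : Z) e : 0 < e -> exists K, (1 < K)%N /\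
  forall x, exists M, Rabs (grid K r M - x) < e.
Proof.
move=> e0; have [n Hn] := INR_unbounded (3 / e).
exists n.+2; split=> // x.
have q0 := pow3_gt0 n.
have small : 24 / (8 * 3 ^ n.+2) < e.
  have -> : 24 / (8 * 3 ^ n.+2) = 1 / 3 / 3 ^ n by rewrite /=; field; lra.
  apply: (Rmult_lt_reg_r (3 ^ n)) => //.
  have -> : 1 / 3 / 3 ^ n * 3 ^ n = 1 / 3 by field; lra.
  have := poly n 2 ltac:(lra); have -> : 1 + 2 = 3 by lra.
  move=> P; have : 3 < e * INR n.
    have := Rmult_lt_compat_l e _ _ e0 Hn.
    by have -> : e * (3 / e) = 3 by field; lra.
  have := Rmult_le_compat_l e _ _ (Rlt_le _ _ e0) P; lra.
have w0 : 0 < 8 * 3 ^ n.+2 by have := pow3_gt0 n.+2; lra.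
set w := 8 * 3 ^ n.+2 in w0 small *.
exists (Int_part ((x * w - IZR r) / 24)); set k := Int_part _.
have [h1 h2] := base_Int_part ((x * w - IZR r) / 24); rewrite -/k in h1 h2.
have E : x = (x * w) / w by field; lra.
have -> : grid n.+2 r k - x = (24 * IZR k + IZR r - x * w) / w.
  by rewrite /grid -/w {1}E; field; lra.
apply: Rabs_def1.
- apply: Rle_lt_trans e0; apply: (Rmult_le_reg_r w) => //.
  by have -> : (24 * IZR k + IZR r - x * w) / w * w = 24 * IZR k + IZR r - x * w
    by [field; lra]; lra.
- suff : - (24 / w) < (24 * IZR k + IZR r - x * w) / w by lra.
  apply: (Rmult_lt_reg_r w) => //.
  have -> : (24 * IZR k + IZR r - x * w) / w * w = 24 * IZR k + IZR r - x * w.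
    by field; lra.
  by have -> : - (24 / w) * w = -24 by [field; lra]; lra.
Qed.

Lemma not_near_int_fraction K (z : Z) : (0 < K)%N -> (forall y, z <> Z.mul 3 y) ->
  ~ near_int (1 / (8 * 3 ^ K)) (IZR z / (8 * 3 ^ K)).
Proof.
case: K => // K _ nd [k [H1 H2]].
have w0 := pow3_gt0 K; have [y Hy] := pow3_IZR K.
have Ew : 8 * 3 ^ K.+1 = 24 * IZR y by rewrite Hy /=; ring.
rewrite Ew in H1 H2; have y0 : 0 < 24 * IZR y by rewrite Hy; lra.
have A := Rmult_lt_compat_r _ _ _ y0 H1.
have B := Rmult_lt_compat_r _ _ _ y0 H2.
have E1 : IZR z / (24 * IZR y) * (24 * IZR y) = IZR z by field; lra.
have E2 : (IZR k - 1 / (24 * IZR y)) * (24 * IZR y) = IZR k * (24 * IZR y) - 1.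
  by field; lra.
have E3 : (IZR k + 1 / (24 * IZR y)) * (24 * IZR y) = IZR k * (24 * IZR y) + 1.
  by field; lra.
rewrite E1 E2 in A; rewrite E1 E3 in B.
have A' : IZR (Z.mul k (Z.mul 24 y)) < IZR z + 1 by rewrite !mult_IZR; lra.
have B' : IZR z < IZR (Z.mul k (Z.mul 24 y)) + 1 by rewrite !mult_IZR; lra.
apply: (nd (Z.mul k (Z.mul 8 y))).
move: (IZR_lt_succ A') (IZR_lt_succ B'); lia.
Qed.

(** Over the denominator [8 * 3 ^ K] both differences have a numerator congruent to - r modulo 3:
    the term with the factor [3 ^ n] vanishes modulo 3, and so does the contribution of 1/3, since K
    > 1. Such a fraction is not an integer. *)
Lemma grid_orbit_far K r M M' n : (1 < K)%N -> (0 < n)%N ->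
  (forall y, r <> Z.mul 3 y) ->
  ~ near_int (1 / (8 * 3 ^ K)) (3 ^ n * grid K r M - grid K r M') /\
  ~ near_int (1 / (8 * 3 ^ K)) (3 ^ n * grid K r M - (grid K r M' + 1 / 3)).
Proof.
case: n => // n; case: K => // K K0 _ nd.
have w0 := pow3_gt0 K; have w1 : 0 < 3 ^ K.+1 := pow3_gt0 K.+1.
have [y Hy] := pow3_IZR n; have [x Hx] : exists x, 3 ^ K = 3 * IZR x.
  case: K K0 {w0 w1} => // K _; have [x Hx] := pow3_IZR K.
  by exists x; rewrite Hx.
pose N := Z.add (Z.mul 24 M) r; pose N' := Z.add (Z.mul 24 M') r.
have E (k : Z) : exists z, IZR z / (8 * 3 ^ K.+1) =
    3 ^ n.+1 * grid K.+1 r M - (grid K.+1 r M' + IZR k * (3 ^ K * 8 / (8 * 3 ^ K.+1))) /\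
    forall y, z <> Z.mul 3 y.
  exists (Z.sub (Z.sub (Z.mul (Z.mul 3 y) N) N') (Z.mul k (Z.mul 24 x))); split.
    rewrite !(minus_IZR, mult_IZR) /N /N' !(plus_IZR, mult_IZR) /grid -[3 ^ n.+1]/(3 * 3 ^ n) -Hy Hx.
    by field; lra.
  move=> u Hu; apply: (nd (Z.sub (Z.sub (Z.sub (Z.mul y N) (Z.mul 8 M')) (Z.mul k (Z.mul 8 x))) u)).
  by move: Hu; rewrite /N'; lia.
split.
- have [z [Ez nz]] := E Z0; rewrite Rmult_0_l Rplus_0_r in Ez.
  by rewrite -Ez; apply: not_near_int_fraction.
- have [z [Ez nz]] := E 1%Z.
  have E3 : 1 * (3 ^ K * 8 / (8 * 3 ^ K.+1)) = 1 / 3 by rewrite /=; field; lra.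
  by rewrite E3 in Ez; rewrite -Ez; apply: not_near_int_fraction.
Qed.

Lemma grid_pow3 K r M : eq_mod1 (3 ^ K * grid K r M) (IZR r / 8).
Proof.
exists (Z.mul 3 M); rewrite mult_IZR /grid; field.
by have := pow3_gt0 K; lra.
Qed.

Lemma grid_no_limit_triangle K q r M M' : (1 < K)%N -> (0 < q)%N ->
  (forall y, r <> Z.mul 3 y) -> eq_mod1 (3 ^ q * (IZR r / 8)) (IZR r / 8) ->
  let a := grid K r M in let b := grid K r M' in
  a + 1 / 3 < b -> b < a + 2 / 3 ->
  (forall w, eq_mod1 (3 ^ q * w) w -> ~ eq_mod1 w (IZR r / 8) ->
    (forall n e, e = a \/ e = b ->
      ~ linked (3 ^ n * (IZR r / 8)) (3 ^ n * w) e (e + 1 / 3)) -> False) ->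
  forall t, limit_triangle a b t -> nondegenerate t -> False.
Proof.
move=> K1 q0 nd per a b ab1 ab2 nofix t.
pose m := Rmin (b - a - 1 / 3) (a + 2 / 3 - b).
have m1 : m <= b - a - 1 / 3 := Rmin_l _ _.
have m2 : m <= a + 2 / 3 - b := Rmin_r _ _.
have m0 : 0 < m by apply: Rmin_glb_lt; lra.
have D0 : 0 < 1 / (8 * 3 ^ K).
  by apply: Rdiv_lt_0_compat; first lra; have := pow3_gt0 K; lra.
apply: (no_limit_triangle m0 D0 (ltnW K1) q0 _ _ _ _ per nofix); try lra.
- by move=> n c e n0 [->|->] [->|->]; apply: grid_orbit_far.
- by move=> c [->|->]; apply: grid_pow3.
Qed.

(** The condition on [6 * x] excludes the positions 0, 1/6, 1/2 and 2/3 of x, where the two chords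
    share an endpoint. *)
Lemma unlinked_diameter x : (forall k, 6 * x <> IZR k) ->
  ~ linked 0 (1 / 2) x (x + 1 / 3) -> exists i,
  (0 < x + IZR i /\ x + IZR i < 1 / 6) \/ (1 / 2 < x + IZR i /\ x + IZR i < 2 / 3).
Proof.
move=> nz nl; have [i Hi] := lift_ge 0 x; exists i.
have ne k : 6 * (x + IZR i) <> IZR k.
  by move=> E; apply: (nz (Z.sub k (Z.mul 6 i))); pushZ; lra.
have n0 := ne Z0; have n1 := ne 1%Z; have n3 := ne 3%Z; have n4 := ne 4%Z.
apply: NNPP => H; apply: nl.
case: (Rlt_le_dec (x + IZR i) (1 / 2)) => L.
- by left; exists i, Z0, i; lra.
- by right; exists (Z.sub i 1), Z0, i; pushZ; lra.
Qed.

(* The orbit {1/4, 3/4} cannot be joined to another orbit of period 2 when the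
   chords at e and f separate 1/4 from 3/4. *)
Lemma quarter_no_fixed_leaf e f k l : 0 < e + IZR k -> e + IZR k < 1 / 6 ->
  1 / 2 < f + IZR l -> f + IZR l < 2 / 3 ->
  forall w, eq_mod1 (3 ^ 2 * w) w -> ~ eq_mod1 w (1 / 4) ->
  ~ linked (1 / 4) w e (e + 1 / 3) -> linked (3 / 4) (3 * w) f (f + 1 / 3).
Proof.
move=> e1 e2 f1 f2 w [n Hn] ne nl; rewrite /= in Hn.
have [i Hi] := lift_gt (fun E => ne (eq_mod1_sym E)).
have Ew : 8 * (w + IZR i) = IZR (Z.add n (Z.mul 8 i)) by pushZ; lra.
set j := Z.add n (Z.mul 8 i) in Ew.
have : j = 3%Z \/ j = 9%Z.
  (* Points fixed by two triplings are eighths, and the chord at e leaves only 3/8 and 9/8 as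
     partners of 1/4. Their images are 1/8 and 3/8 modulo 1, which the chord at f separates from
     3/4. *)
  case: (Rle_lt_dec (w + IZR i) (e + IZR k + 1 / 3)) => L.
    left; have A : IZR j < IZR 3 + 1 by lra.
    have B : IZR 2 < IZR j by lra.
    by move: (IZR_lt_succ A) (lt_IZR _ _ B); lia.
  case: (Rle_lt_dec (e + IZR k + 1) (w + IZR i)) => L'.
    right; have A : IZR j < IZR 9 + 1 by lra.
    have B : IZR 8 < IZR j by lra.
    by move: (IZR_lt_succ A) (lt_IZR _ _ B); lia.
  by case: nl; right; exists k, i, (Z.add k 1); pushZ; lra.
case=> Ej; rewrite Ej in Ew; right.
- by exists l, (Z.mul 3 i), (Z.add l 1); pushZ; lra.
- by exists l, (Z.sub (Z.mul 3 i) 2), (Z.add l 1); pushZ; lra.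
Qed.

Lemma grid8_not_sixth K M : (1 < K)%N -> forall k, 6 * grid K 8 M <> IZR k.
Proof.
case: K => [|[|K]] // _ k; rewrite /grid => E.
have [y Hy] := pow3_IZR K; have y0 := pow3_gt0 K.
have : IZR (Z.add (Z.mul 6 M) 2) = IZR (Z.mul 3 (Z.mul k y)).
  by rewrite plus_IZR !mult_IZR -E Hy /=; field; lra.
by move/eq_IZR; lia.
Qed.

(** Preimages of the fixed point 0 are tried first, written with r = 8 because r must not be
    divisible by 3. The only other fixed point of tripling is 1/2, so they work if a chord crosses
    {0, 1/2}. Otherwise both chords lie in known arcs, and nearby preimages of 1/4 (r = 2, period 2)
    work by [quarter_no_fixed_leaf]. *)
Lemma generic_parameters a0 b0 e :
  0 < e -> a0 + 1 / 3 <= b0 -> b0 <= a0 + 2 / 3 ->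
  exists a b, Rabs (a - a0) < e /\ Rabs (b - b0) < e /\
    a + 1 / 3 < b /\ b < a + 2 / 3 /\
    forall t, limit_triangle a b t -> nondegenerate t -> False.
Proof.
move=> e0 H1 H2.
pose d := Rmin e 1; have d0 : 0 < d by apply: Rmin_glb_lt; lra.
have [de d1] : d <= e /\ d <= 1 by split; [apply: Rmin_l | apply: Rmin_r].
(* Moving b0 towards the middle of its range creates a margin d / 6 on both sides. Two successive
   approximations of both parameters, each with error at most d / 40, stay within it. *)
pose b' := b0 + d * (a0 + 1 / 2 - b0).
have [B1 B2] : a0 + 1 / 3 + d / 6 <= b' /\ b' <= a0 + 2 / 3 - d / 6.
  have A1 := Rmult_le_compat_l (1 - d) 0 (b0 - a0 - 1 / 3) ltac:(lra) ltac:(lra).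
  have A2 := Rmult_le_compat_l (1 - d) 0 (a0 + 2 / 3 - b0) ltac:(lra) ltac:(lra).
  by rewrite /b'; lra.
have [B3 B4] : - (d / 6) <= b' - b0 /\ b' - b0 <= d / 6.
  have A1 := Rmult_le_compat_l d 0 (b0 - a0 - 1 / 3) ltac:(lra) ltac:(lra).
  have A2 := Rmult_le_compat_l d 0 (a0 + 2 / 3 - b0) ltac:(lra) ltac:(lra).
  by rewrite /b'; lra.
have d40 : 0 < d / 40 by lra.
have [K [K1 dens]] := grid_dense 8 d40.
have [M /Rabs_def2 HM] := dens a0; have [M' /Rabs_def2 HM'] := dens b'.
set a := grid K 8 M in HM; set b := grid K 8 M' in HM'.
have ab1 : a + 1 / 3 < b by lra.
have ab2 : b < a + 2 / 3 by lra.
case: (classic (linked 0 (1 / 2) a (a + 1 / 3) \/ linked 0 (1 / 2) b (b + 1 / 3))) => [HL|].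
  exists a, b; split; first by apply: Rabs_def1; lra.
  split; first by apply: Rabs_def1; lra.
  split=> //; split=> //.
  apply: (@grid_no_limit_triangle K 1) => //; first by move=> y; lia.
    by exists 2%Z; rewrite /=; lra.
  move=> w [k Hk] nw nl; rewrite /= in Hk.
  have w12 : eq_mod1 w (1 / 2).
    case: (Z.Even_or_Odd k) => -[j Ej]; rewrite Ej in Hk.
    - by case: nw; exists (Z.sub j 1); move: Hk; pushZ; lra.
    - by exists j; move: Hk; pushZ; lra.
  have E0 : eq_mod1 (3 ^ 0 * (8 / 8)) 0 by exists 1%Z; rewrite /=; lra.
  have E1 : eq_mod1 (3 ^ 0 * w) (1 / 2) by rewrite /= Rmult_1_l.
  case: HL => HL.
  - by apply: (nl O a (or_introl erefl)); apply: linked_eq_mod1 E0 E1 _ _ HL; apply: eq_mod1_refl.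
  - by apply: (nl O b (or_intror erefl)); apply: linked_eq_mod1 E0 E1 _ _ HL; apply: eq_mod1_refl.
move/not_or_and => [na nb].
have [i Hi] := unlinked_diameter (@grid8_not_sixth K M K1) na.
have [j Hj] := unlinked_diameter (@grid8_not_sixth K M' K1) nb.
rewrite -/a -/b in Hi Hj.
have [eta [eta0 Heta]] : exists eta, 0 < eta /\ forall x y,
    Rabs (x - a) < eta -> Rabs (y - b) < eta -> exists u v k l,
    (u = x /\ v = y \/ u = y /\ v = x) /\
    0 < u + IZR k /\ u + IZR k < 1 / 6 /\ 1 / 2 < v + IZR l /\ v + IZR l < 2 / 3.
  pose u := a + IZR i; pose v := b + IZR j.
  have I : IZR (Z.sub i j) = u - a - (v - b) by pushZ; rewrite /u /v; ring.
  (* Both points cannot lie in the same arc of length 1/6, as a and b are more than 1/3 apart on the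
     circle. In the other two cases the strict inequalities persist under small changes. *)
  case: Hi Hj => -[A1 A2] [[A3 A4]|[A3 A4]].
  - exfalso; have L1 : -1 < IZR (Z.sub i j) by rewrite I /u /v; lra.
    have L2 : IZR (Z.sub i j) < 1 by rewrite I /u /v; lra.
    have Z0' : Z.sub i j = Z0 by move: (lt_IZR (-1) _ L1) (lt_IZR _ 1 L2); lia.
    by rewrite Z0' in I; rewrite /u /v in I; lra.
  - exists (Rmin (Rmin u (1 / 6 - u)) (Rmin (v - 1 / 2) (2 / 3 - v))).
    split; first by repeat apply: Rmin_glb_lt; rewrite /u /v; lra.
    move=> x y; set r := Rmin _ _ => /Rabs_def2 Hx /Rabs_def2 Hy.
    exists x, y, i, j; split; first by left.
    have := (Rmin_l (Rmin u (1 / 6 - u)) (Rmin (v - 1 / 2) (2 / 3 - v)),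
      Rmin_r (Rmin u (1 / 6 - u)) (Rmin (v - 1 / 2) (2 / 3 - v)), Rmin_l u (1 / 6 - u),
      Rmin_r u (1 / 6 - u), Rmin_l (v - 1 / 2) (2 / 3 - v), Rmin_r (v - 1 / 2) (2 / 3 - v)).
    by move=> [[[[[]]]]]; rewrite -/r /u /v; lra.
  - exists (Rmin (Rmin v (1 / 6 - v)) (Rmin (u - 1 / 2) (2 / 3 - u))).
    split; first by repeat apply: Rmin_glb_lt; rewrite /u /v; lra.
    move=> x y; set r := Rmin _ _ => /Rabs_def2 Hx /Rabs_def2 Hy.
    exists y, x, j, i; split; first by right.
    have := (Rmin_l (Rmin v (1 / 6 - v)) (Rmin (u - 1 / 2) (2 / 3 - u)),
      Rmin_r (Rmin v (1 / 6 - v)) (Rmin (u - 1 / 2) (2 / 3 - u)), Rmin_l v (1 / 6 - v),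
      Rmin_r v (1 / 6 - v), Rmin_l (u - 1 / 2) (2 / 3 - u), Rmin_r (u - 1 / 2) (2 / 3 - u)).
    by move=> [[[[[]]]]]; rewrite -/r /u /v; lra.
  - exfalso; have L1 : -1 < IZR (Z.sub i j) by rewrite I /u /v; lra.
    have L2 : IZR (Z.sub i j) < 1 by rewrite I /u /v; lra.
    have Z0' : Z.sub i j = Z0 by move: (lt_IZR (-1) _ L1) (lt_IZR _ 1 L2); lia.
    by rewrite Z0' in I; rewrite /u /v in I; lra.
pose eta' := Rmin eta (d / 40).
have eta'0 : 0 < eta' by apply: Rmin_glb_lt.
have [h1 h2] : eta' <= eta /\ eta' <= d / 40 by split; [apply: Rmin_l | apply: Rmin_r].
have [L [L1 dens']] := grid_dense 2 eta'0.
have [N HN] := dens' a; have [N' HN'] := dens' b.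
have [u [v [k [l [Huv [Hu1 [Hu2 [Hv1 Hv2]]]]]]]] :=
  Heta _ _ (Rlt_le_trans _ _ _ HN h1) (Rlt_le_trans _ _ _ HN' h1).
move/Rabs_def2: HN => HN; move/Rabs_def2: HN' => HN'.
exists (grid L 2 N), (grid L 2 N'); split; first by apply: Rabs_def1; lra.
split; first by apply: Rabs_def1; lra.
have ab3 : grid L 2 N + 1 / 3 < grid L 2 N' by lra.
have ab4 : grid L 2 N' < grid L 2 N + 2 / 3 by lra.
split=> //; split=> //; apply: (@grid_no_limit_triangle L 2) => //; first by move=> y; lia.
  by exists 2%Z; rewrite /=; lra.
move=> w Hw nw nl.
have E4 : 2 / 8 = 1 / 4 by lra.
rewrite E4 in nw nl.
have nu : ~ linked (1 / 4) w u (u + 1 / 3).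
  have := nl O u; rewrite /= !Rmult_1_l; apply.
  by case: Huv => -[-> _]; [left | right].
have := quarter_no_fixed_leaf Hu1 Hu2 Hv1 Hv2 Hw nw nu.
have := nl 1%N v; have -> : 3 ^ 1 * (1 / 4) = 3 / 4 by rewrite /=; lra.
rewrite /= Rmult_1_r; apply.
by case: Huv => -[_ ->]; [right | left].
Qed.

(** * Convex hulls in the disk and crossing chords *)

Lemma cos_mod1 x y : eq_mod1 x y -> cos (2 * PI * x) = cos (2 * PI * y).
Proof.
move=> [k Hk].
have H n u v : u = v + INR n -> cos (2 * PI * u) = cos (2 * PI * v).
  move=> ->; rewrite -(cos_period (2 * PI * v) n); congr cos; ring.
case: (Z.le_ge_cases 0 k) => k0.
- by apply: (H (Z.to_nat k)); rewrite INR_IZR_INZ Z2Nat.id //; lra.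
- apply/esym/(H (Z.to_nat (Z.opp k))); rewrite INR_IZR_INZ Z2Nat.id; last lia.
  by rewrite opp_IZR; lra.
Qed.

Lemma emb_mod1 x y : eq_mod1 x y -> emb x = emb y.
Proof.
move=> H; rewrite /emb (cos_mod1 H); congr pair; rewrite !sin_cos; congr (- _).
have E u : PI / 2 + 2 * PI * u = 2 * PI * (u + 1 / 4) by field.
by rewrite !E; apply: cos_mod1; have [k Hk] := H; exists k; lra.
Qed.

Lemma ConvHull_point (A : R -> Prop) x : A x -> ConvHull A (emb x).
Proof.
move=> Ax; exists O, (fun _ => 1), (fun _ => x); split; first by split=> //; lra.
by rewrite /=; lra.
Qed.

Lemma ConvHull_segment (A : R -> Prop) x y w p : A x -> A y -> 0 <= w -> w <= 1 ->
  p.1 = (1 - w) * (emb x).1 + w * (emb y).1 ->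
  p.2 = (1 - w) * (emb x).2 + w * (emb y).2 -> ConvHull A p.
Proof.
move=> Ax Ay w0 w1 E1 E2.
exists 1%N, (fun i => if i is O then 1 - w else w), (fun i => if i is O then x else y).
split; last by rewrite /sum_f_R0 E1 E2; lra.
by case=> [|i] _; split=> //; lra.
Qed.

(** Twice the signed area of a triangle, positive for counterclockwise vertices. *)
Definition area (P Q S : R * R) : R :=
  P.1 * Q.2 - P.2 * Q.1 + (Q.1 * S.2 - Q.2 * S.1) + (S.1 * P.2 - S.2 * P.1).

(** For p and q half the angles of the arcs from x to y and from y to z, the area is
    [4 * sin p * sin q * sin (p + q)], and all three angles lie between 0 and PI. *)
Lemma area_gt0 x y z : x < y -> y < z -> z < x + 1 ->
  0 < area (emb x) (emb y) (emb z).
Proof.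
move=> xy yz zx; have PI0 := PI_RGT_0.
pose p := PI * (y - x); pose q := PI * (z - y).
have : area (emb x) (emb y) (emb z) = 4 * sin p * sin q * sin (p + q).
  have -> : area (emb x) (emb y) (emb z) =
      sin (2 * p) + sin (2 * q) - sin (2 * (p + q)).
    have -> : 2 * p = 2 * PI * y - 2 * PI * x by rewrite /p; ring.
    have -> : 2 * q = 2 * PI * z - 2 * PI * y by rewrite /q; ring.
    have -> : 2 * (p + q) = 2 * PI * z - 2 * PI * x by rewrite /p /q; ring.
    by rewrite !sin_minus /area /=; ring.
  rewrite Rmult_plus_distr_l !sin_plus !cos_2a !sin_2a.
  have Cp : cos p * cos p = 1 - sin p * sin p.
    by have := sin2_cos2 p; rewrite /Rsqr; lra.
  have Cq : cos q * cos q = 1 - sin q * sin q.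
    by have := sin2_cos2 q; rewrite /Rsqr; lra.
  by rewrite Cp Cq; ring.
move=> ->.
have pos u : 0 < u -> u < 1 -> 0 < sin (PI * u).
  move=> u0 u1; apply: sin_gt_0; first exact: Rmult_lt_0_compat.
  by have := Rmult_lt_compat_l PI _ _ PI0 u1; lra.
have -> : p + q = PI * (z - x) by rewrite /p /q; ring.
by repeat apply: Rmult_lt_0_compat; try (apply: pos); lra.
Qed.

(** The diagonals of the quadrilateral x u y v meet at the point where each vertex is weighted by
    the area of the triangle of the other three. *)
Lemma cyc4_hulls_meet (A B : R -> Prop) x u y v : cyc4 x u y v ->
  A x -> A y -> B u -> B v -> ~ hulls_disjoint A B.
Proof.
move=> [i [j [k [H1 [H2 [H3 H4]]]]]] Ax Ay Bu Bv D.
have shift z l : emb (z + IZR l) = emb z by apply: emb_mod1; exists l; ring.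
have a1 := area_gt0 H2 H3 ltac:(lra).
have a2 := area_gt0 (Rlt_trans _ _ _ H1 H2) H3 H4.
have a3 := area_gt0 H1 (Rlt_trans _ _ _ H2 H3) H4.
have a4 := area_gt0 H1 H2 ltac:(lra).
rewrite !shift in a1 a2 a3 a4.
set wx := area (emb u) _ _ in a1; set wu := area (emb x) (emb y) (emb v) in a2.
set wy := area (emb x) (emb u) (emb v) in a3; set wv := area (emb x) (emb u) (emb y) in a4.
have S : wx + wy = wu + wv by rewrite /wx /wy /wu /wv /area; ring.
have S0 : wx + wy <> 0 by lra.
have S0' : wu + wv <> 0 by lra.
have ratio a b : 0 < a -> 0 < b -> 0 <= a / (b + a) /\ a / (b + a) <= 1.
  move=> a0 b0; have ba : 0 < b + a by lra.
  split; first by apply: Rlt_le; apply: Rdiv_lt_0_compat.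
  apply: (Rmult_le_reg_r (b + a)) => //.
  by have -> : a / (b + a) * (b + a) = a by [field; lra]; lra.
have [r1 r2] := ratio wy wx a3 a1; have [r3 r4] := ratio wv wu a4 a2.
pose p := ((wx * (emb x).1 + wy * (emb y).1) / (wx + wy),
           (wx * (emb x).2 + wy * (emb y).2) / (wx + wy)).
apply: (D p).
- apply: (ConvHull_segment Ax Ay r1 r2); rewrite /p; cbn [fst snd]; field; lra.
- have F1 : wx * (emb x).1 + wy * (emb y).1 = wu * (emb u).1 + wv * (emb v).1.
    by rewrite /wx /wy /wu /wv /area; ring.
  have F2 : wx * (emb x).2 + wy * (emb y).2 = wu * (emb u).2 + wv * (emb v).2.
    by rewrite /wx /wy /wu /wv /area; ring.
  by apply: (ConvHull_segment Bu Bv r3 r4); rewrite /p; cbn [fst snd];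
    rewrite ?F1 ?F2 S; field; lra.
Qed.

Lemma linked_hulls_meet (A B : R -> Prop) x y u v : linked x y u v ->
  A x -> A y -> B u -> B v -> ~ hulls_disjoint A B.
Proof. by case=> H Ax Ay Bu Bv; apply: cyc4_hulls_meet H _ _ _ _. Qed.

Lemma weighted_sum_sign (w f : nat -> R) n :
  (forall i, (i <= n)%N -> 0 <= w i) ->
  ((forall i, (i <= n)%N -> 0 <= f i) -> 0 <= sum_f_R0 (fun i => w i * f i) n) /\
  ((forall i, (i <= n)%N -> 0 < f i) -> 0 < sum_f_R0 w n ->
     0 < sum_f_R0 (fun i => w i * f i) n).
Proof.
elim: n => [|n IH] Hw.
  have w0 := Hw O isT; split=> /= Hf; first by apply: Rmult_le_pos => //; apply: Hf.
  by move=> ?; apply: Rmult_lt_0_compat => //; apply: Hf.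
have [IH1 IH2] := IH (fun i le => Hw i (leqW le)).
have wn := Hw n.+1 (leqnn _); split=> /= Hf.
  have := IH1 (fun i le => Hf i (leqW le)).
  by have := Rmult_le_pos _ _ wn (Hf n.+1 (leqnn _)); lra.
have fn := Hf n.+1 (leqnn _) => pos.
case: (Rle_lt_or_eq_dec _ _ wn) => wn'.
  have := IH1 (fun i le => Rlt_le _ _ (Hf i (leqW le))).
  by have := Rmult_lt_0_compat _ _ wn' fn; lra.
have := IH2 (fun i le => Hf i (leqW le)); rewrite -wn' in pos *; lra.
Qed.

(** An affine function respects convex combinations, so it is positive on the hull of A and zero on
    that of B. *)
Lemma separated_hulls_disjoint (A B : R -> Prop) (l1 l2 l0 : R) :
  let f x := l1 * (emb x).1 + l2 * (emb x).2 - l0 in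
  (forall x, A x -> 0 < f x) -> (forall x, B x -> f x = 0) -> hulls_disjoint A B.
Proof.
move=> f fA fB p [n [w [t [Ht [Sw [p1 p2]]]]]] [n' [w' [t' [Ht' [Sw' [p1' p2']]]]]].
have E k (v u : nat -> R) : sum_f_R0 (fun i => v i * f (u i)) k =
    l1 * sum_f_R0 (fun i => v i * (emb (u i)).1) k +
    l2 * sum_f_R0 (fun i => v i * (emb (u i)).2) k - l0 * sum_f_R0 v k.
  by elim: k => [|k IH]; [rewrite /f /= | rewrite !tech5 IH /f]; ring.
have [_ pos] := weighted_sum_sign (fun i => f (t i)) (fun i le => proj1 (Ht i le)).
have := pos (fun i le => fA _ (proj2 (Ht i le))); rewrite Sw => /(_ Rlt_0_1).
have zero : sum_f_R0 (fun i => w' i * f (t' i)) n' = 0.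
  elim: (n') Ht' => [|k IH] H; first by rewrite /= fB ?Rmult_0_r //; case: (H O isT).
  rewrite tech5 IH => [|i le]; last by apply: H; apply: leqW.
  by rewrite fB ?Rmult_0_r ?Rplus_0_r //; case: (H k.+1 (leqnn _)).
move: zero; rewrite !E Sw Sw' -p1 -p2 -p1' -p2'; lra.
Qed.

(** * The two sides of a critical chord *)

Definition inside (c x : R) : Prop := exists i, c < x + IZR i /\ x + IZR i < c + 1 / 3.
Definition outside (c x : R) : Prop :=
  exists i, c + 1 / 3 < x + IZR i /\ x + IZR i < c + 1.
Definition endpoint (c x : R) : Prop := eq_mod1 x c \/ eq_mod1 x (c + 1 / 3).

Lemma side_cases c x : [\/ endpoint c x, inside c x | outside c x].
Proof.
case: (classic (endpoint c x)) => [|ne]; first by constructor 1.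
have [i Hi] := lift_gt (fun E => ne (or_introl (eq_mod1_sym E))).
case: (Rtotal_order (x + IZR i) (c + 1 / 3)) => [lt|[eq|gt]].
- by constructor 2; exists i; lra.
- by case: ne; right; exists (Z.opp i); pushZ; lra.
- by constructor 3; exists i; lra.
Qed.

Lemma inside_not_outside c x : inside c x -> outside c x -> False.
Proof.
move=> [i Hi] [j Hj].
have A : IZR i < IZR j by lra.
have B : IZR j < IZR i + 1 by lra.
by move: (lt_IZR _ _ A) (IZR_lt_succ B); lia.
Qed.

Lemma inside_outside_linked c x y : inside c x -> outside c y ->
  linked c (c + 1 / 3) x y.
Proof. by move=> [i Hi] [j Hj]; left; exists i, Z0, j; lra. Qed.

Lemma cos_lt_half u : PI / 3 < u -> u < 5 * (PI / 3) -> cos u < 1 / 2.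
Proof.
move=> u1 u2; have PI0 := PI_RGT_0; rewrite -cos_PI3.
case: (Rle_lt_dec u PI) => L; first by apply: cos_decreasing_1; lra.
have -> : cos u = cos (2 * PI - u).
  have -> : 2 * PI - u = - u + 2 * INR 1 * PI by rewrite /=; ring.
  by rewrite cos_period cos_neg.
by apply: cos_decreasing_1; lra.
Qed.

Lemma cos_gt_half u : - (PI / 3) < u -> u < PI / 3 -> 1 / 2 < cos u.
Proof.
move=> u1 u2; have PI0 := PI_RGT_0; rewrite -cos_PI3.
case: (Rle_lt_dec 0 u) => L; first by apply: cos_decreasing_1; lra.
by rewrite -(cos_neg u); apply: cos_decreasing_1; lra.
Qed.

(* The line through the chord {c, c + 1/3} is [<p, emb (c + 1/6)> = 1/2]. *)
Lemma same_side_hulls_disjoint (A B : R -> Prop) c :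
  (forall x, A x -> inside c x) \/ (forall x, A x -> outside c x) ->
  (forall x, B x -> endpoint c x) -> hulls_disjoint A B.
Proof.
pose g x := cos (2 * PI * (x - (c + 1 / 6))).
have gE x : g x = (emb x).1 * cos (2 * PI * (c + 1 / 6)) + (emb x).2 * sin (2 * PI * (c + 1 / 6)).
  by rewrite /g Rmult_minus_distr_l cos_minus.
have g_mod x i : g (x + IZR i) = g x by apply: cos_mod1; exists i; lra.
have PI0 := PI_RGT_0.
have gin x : inside c x -> 1 / 2 < g x.
  move=> [i [h1 h2]]; rewrite -(g_mod x i); apply: cos_gt_half.
  - by have := Rmult_lt_compat_l (2 * PI) _ _ ltac:(lra) h1; lra.
  - by have := Rmult_lt_compat_l (2 * PI) _ _ ltac:(lra) h2; lra.
have gout x : outside c x -> g x < 1 / 2.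
  move=> [i [h1 h2]]; rewrite -(g_mod x i); apply: cos_lt_half.
  - by have := Rmult_lt_compat_l (2 * PI) _ _ ltac:(lra) h1; lra.
  - by have := Rmult_lt_compat_l (2 * PI) _ _ ltac:(lra) h2; lra.
have gend x : endpoint c x -> g x = 1 / 2.
  rewrite -cos_PI3; case=> -[i Hi]; have -> : x = (x - IZR i) + IZR i by lra.
  - rewrite g_mod /g -cos_neg; congr cos; rewrite -Hi; field.
  - rewrite g_mod /g; congr cos; rewrite -Hi; field.
move=> [sA|sA] eB.
- apply: (@separated_hulls_disjoint A B (cos (2 * PI * (c + 1 / 6)))
    (sin (2 * PI * (c + 1 / 6))) (1 / 2)) => x.
  + by move=> /sA /gin; rewrite gE; lra.
  + by move=> /eB /gend; rewrite gE; lra.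
- apply: (@separated_hulls_disjoint A B (- cos (2 * PI * (c + 1 / 6)))
    (- sin (2 * PI * (c + 1 / 6))) (- (1 / 2))) => x.
  + by move=> /sA /gout; rewrite gE; lra.
  + by move=> /eB /gend; rewrite gE; lra.
Qed.

Lemma inside_not_endpoint c x : inside c x -> ~ endpoint c x.
Proof.
move=> [i Hi] [[j Hj]|[j Hj]].
- have A : IZR 0 < IZR (Z.add i j) by pushZ; lra.
  have B : IZR (Z.add i j) < IZR 0 + 1 by pushZ; lra.
  by move: (lt_IZR _ _ A) (IZR_lt_succ B); lia.
- have A : IZR (-1) < IZR (Z.add i j) by pushZ; lra.
  have B : IZR (Z.add i j) < IZR (-1) + 1 by pushZ; lra.
  by move: (lt_IZR _ _ A) (IZR_lt_succ B); lia.
Qed.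

Lemma outside_not_endpoint c x : outside c x -> ~ endpoint c x.
Proof.
move=> [i Hi] [[j Hj]|[j Hj]].
- have A : IZR 0 < IZR (Z.add i j) by pushZ; lra.
  have B : IZR (Z.add i j) < IZR 0 + 1 by pushZ; lra.
  by move: (lt_IZR _ _ A) (IZR_lt_succ B); lia.
- have A : IZR 0 < IZR (Z.add i j) by pushZ; lra.
  have B : IZR (Z.add i j) < IZR 0 + 1 by pushZ; lra.
  by move: (lt_IZR _ _ A) (IZR_lt_succ B); lia.
Qed.

Lemma inS_eq x y : inS x -> inS y -> eq_mod1 x y -> x = y.
Proof.
move=> [x0 x1] [y0 y1] [k Hk].
have A : IZR (-1) < IZR k by lra.
have B : IZR k < IZR 0 + 1 by lra.
have E : k = Z0 by move: (lt_IZR _ _ A) (IZR_lt_succ B); lia.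
by rewrite E in Hk; lra.
Qed.

Lemma frac_eq_mod1 x : eq_mod1 (frac_part x) x.
Proof. by exists (Z.opp (Int_part x)); rewrite opp_IZR /frac_part; ring. Qed.

Lemma frac_inS x : inS (frac_part x).
Proof. by have := base_fp x; rewrite /inS; lra. Qed.

Lemma eq_mod1_frac x y : eq_mod1 x y -> frac_part x = frac_part y.
Proof.
move=> E; apply: inS_eq; try exact: frac_inS.
apply: eq_mod1_trans (frac_eq_mod1 x) _; apply: eq_mod1_trans E _.
exact: eq_mod1_sym (frac_eq_mod1 y).
Qed.

Lemma sigma3_eq_mod1 x y : sigma3 x = sigma3 y <-> eq_mod1 (3 * x) (3 * y).
Proof.
split=> [E|]; last exact: eq_mod1_frac.
apply: eq_mod1_trans (eq_mod1_sym (frac_eq_mod1 _)) _.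
by rewrite -/(sigma3 x) E; apply: frac_eq_mod1.
Qed.

(** * Critical chords contained in a portrait *)

Definition chord_of (A : {fset R}) (c : R) : Prop := exists x y,
  [/\ x \in A, y \in A, eq_mod1 x c & eq_mod1 y (c + 1 / 3)].

Definition has_chord (Th : portrait) (c : R) : Prop :=
  exists A, A \in Th /\ chord_of A c.

Lemma chord_of_mod1 A c c' : eq_mod1 c c' -> chord_of A c -> chord_of A c'.
Proof.
move=> E [x [y [Hx Hy Ex Ey]]]; exists x, y; split=> //.
- exact: eq_mod1_trans Ex E.
- by apply: eq_mod1_trans Ey _; have [k Hk] := E; exists k; lra.
Qed.

Lemma hole_two_points (A : {fset R}) u v : (forall x, x \in A -> x = u \/ x = v) ->
  u \in A -> v \in A -> u <> v -> hole (fmem A) u v.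
Proof.
move=> HA Au Av uv; split=> //; split=> // x [_ [xu [h1 h2]]] /HA [//|E].
rewrite E in h1 h2; case: (Rtotal_order u v) => [/h1|[//|/h2]]; lra.
Qed.

Lemma pair_chord Th A : is_crit_portrait Th -> A \in Th -> #|` A| = 2%N ->
  exists c, chord_of A c.
Proof.
move=> [inSTh [_ [holes _]]] ATh.
have memA x : (x \in A) = (x \in enum_fset A) by [].
have := fset_uniq A.
case EA : (enum_fset A) => [|u [|v [|]]] //=; rewrite inE andbT => /eqP uv _.
have Au : u \in A by rewrite memA EA !inE eqxx.
have Av : v \in A by rewrite memA EA !inE eqxx orbT.
have HA x : x \in A -> x = u \/ x = v.
  by rewrite memA EA !inE => /orP [/eqP|/eqP]; [left | right].
have /sigma3_eq_mod1 := holes A ATh u v Au Av uv (hole_two_points HA Au Av uv).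
have R x : eq_mod1 x x := eq_mod1_refl x.
case/eq_mod1_third => [E|[E|E]].
- by case: uv; apply: inS_eq => //; apply: inSTh ATh _ _.
- by exists v, v, u.
- by exists u, u, v.
Qed.

(** The numbers 3 (v - u) and 3 (w - v) are positive integers with sum less than 3, so both are
    1. *)
Lemma triple_has_chord Th A u v w : is_crit_portrait Th -> A \in Th ->
  (forall x, x \in A -> [\/ x = u, x = v | x = w]) ->
  u \in A -> v \in A -> w \in A -> u < v -> v < w ->
  has_chord Th u /\ has_chord Th (u + 1 / 3).
Proof.
move=> [inSTh [_ [holes _]]] ATh HA Au Av Aw uv vw.
have huv : hole (fmem A) u v.
  by split=> //; split=> // x [_ [xu [h _]]] /HA [E|E|E]; have := h uv; lra.
have hvw : hole (fmem A) v w.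
  by split=> //; split=> // x [_ [xu [h _]]] /HA [E|E|E]; have := h vw; lra.
have [k Hk] := proj1 (sigma3_eq_mod1 _ _) (holes A ATh u v Au Av ltac:(lra) huv).
have [l Hl] := proj1 (sigma3_eq_mod1 _ _) (holes A ATh v w Av Aw ltac:(lra) hvw).
have [u0 _] := inSTh A ATh u Au; have [_ w1] := inSTh A ATh w Aw.
have Ak : IZR k < IZR 0 by lra.
have Al : IZR l < IZR 0 by lra.
have B : IZR (-3) < IZR (Z.add k l) by pushZ; lra.
have [Ek El] : k = (-1)%Z /\ l = (-1)%Z.
  by move: (lt_IZR _ _ Ak) (lt_IZR _ _ Al) (lt_IZR _ _ B); lia.
rewrite Ek in Hk; rewrite El in Hl.
by split; exists A; split=> //; [exists u, v | exists v, w]; split=> //; exists Z0; lra.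
Qed.

(** The sum condition leaves one triple or two pairs. A triple gives b = a + 1/3, whence the weak
    inequalities; for pairs, the chords do not cross. *)
Lemma portrait_chords Th : is_crit_portrait Th -> exists a b,
  [/\ has_chord Th a, has_chord Th b, a + 1 / 3 <= b & b <= a + 2 / 3].
Proof.
move=> HTh; have [inSTh [card2 [holes [hulls sum2]]]] := HTh.
have memE A : (A \in Th) = (A \in enum_fset Th) by [].
have uTh := fset_uniq Th.
case Es : (enum_fset Th) => [|A [|B s]]; rewrite Es in sum2 uTh.
- by rewrite big_nil in sum2.
- have ATh : A \in Th by rewrite memE Es inE.
  rewrite big_seq1 in sum2.
  have : size (enum_fset A) = 3%N by move: sum2; rewrite subn1; case: (size _) => // n /= ->.
  have memA x : (x \in A) = (x \in enum_fset A) by [].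
  have := fset_uniq A.
  case EA : (enum_fset A) => [|u [|v [|w [|]]]] //=.
  rewrite !inE !negb_or /= ?andbT => /andP [/andP [/eqP uv /eqP uw] /eqP vw] _.
  have Au : u \in A by rewrite memA EA !inE eqxx.
  have Av : v \in A by rewrite memA EA !inE eqxx orbT.
  have Aw : w \in A by rewrite memA EA !inE eqxx !orbT.
  have HA x : x \in A -> [\/ x = u, x = v | x = w].
    by rewrite memA EA !inE => /or3P [/eqP|/eqP|/eqP]; [constructor 1|constructor 2|constructor 3].
  suff [c [c1 c2]] : exists c, has_chord Th c /\ has_chord Th (c + 1 / 3).
    by exists c, (c + 1 / 3); split=> //; lra.
  have T x y z : (forall t, t \in A -> [\/ t = x, t = y | t = z]) ->
      x \in A -> y \in A -> z \in A -> x < y -> y < z ->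
      exists c, has_chord Th c /\ has_chord Th (c + 1 / 3).
    by move=> H Ax Ay Az xy yz; exists x; apply: (triple_has_chord HTh ATh H Ax Ay Az).
  have perm x y z : (forall t, [\/ t = u, t = v | t = w] -> [\/ t = x, t = y | t = z]) ->
      forall t, t \in A -> [\/ t = x, t = y | t = z] by move=> H t /HA /H.
  case: (Rtotal_order u v) => [?|[//|?]]; case: (Rtotal_order u w) => [?|[//|?]];
    case: (Rtotal_order v w) => [?|[//|?]]; try lra.
  + by apply: (T u v w).
  + by apply: (T u w v) => //; apply: perm => t [->|->|->]; [constructor 1|constructor 3|constructor 2].
  + by apply: (T w u v) => //; apply: perm => t [->|->|->]; [constructor 2|constructor 3|constructor 1].
  + by apply: (T v u w) => //; apply: perm => t [->|->|->]; [constructor 2|constructor 1|constructor 3].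
  + by apply: (T v w u) => //; apply: perm => t [->|->|->]; [constructor 3|constructor 1|constructor 2].
  + by apply: (T w v u) => //; apply: perm => t [->|->|->]; [constructor 3|constructor 2|constructor 1].
have ATh : A \in Th by rewrite memE Es inE eqxx.
have BTh : B \in Th by rewrite memE Es !inE eqxx orbT.
have AB : A <> B by move=> E; move: uTh; rewrite E /= inE eqxx.
have [cA cB] : #|` A| = 2%N /\ #|` B| = 2%N.
  move: sum2 (card2 A ATh) (card2 B BTh); rewrite !big_cons.
  case: #|` A| => [|[|[|n]]] //; case: #|` B| => [|[|[|n']]] //;
    rewrite ?subn1 /= ?addSn ?addnS //; rewrite ?addSn ?addnS //.
have [a Ca] := pair_chord HTh ATh cA.
have [b0 Cb0] := pair_chord HTh BTh cB.
have [i Hi] := lift_ge a b0; pose b := b0 + IZR i.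
have Cb : chord_of B b by apply: chord_of_mod1 Cb0; exists (Z.opp i); rewrite /b; pushZ; lra.
have dAB := hulls A B ATh BTh AB.
have nl : ~ linked a (a + 1 / 3) b (b + 1 / 3).
  have [x [y [Ax Ay Ex Ey]]] := Ca; have [x' [y' [Bx By Ex' Ey']]] := Cb.
  move=> /(linked_eq_mod1 Ex Ey Ex' Ey') /linked_hulls_meet H.
  by apply: H dAB.
have nab : ~ eq_mod1 a b.
  have [x [y [Ax Ay Ex Ey]]] := Ca; have [x' [y' [Bx By Ex' Ey']]] := Cb => E.
  apply: (dAB (emb x)); first exact: ConvHull_point.
  have -> : emb x = emb x'.
    by apply: emb_mod1; apply: eq_mod1_trans Ex _; apply: eq_mod1_trans E (eq_mod1_sym Ex').
  exact: ConvHull_point.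
have ab : a <> b by move=> E; apply: nab; rewrite E; apply: eq_mod1_refl.
exists a, b; split; [by exists A | by exists B | |].
(* If b < a + 1/3, then b lies between a and a + 1/3; if b > a + 2/3, then b + 1/3 - 1 does. Either
   way the chords cross. *)
- apply: Rnot_lt_le => L; apply: nl; left.
  by exists Z0, Z0, Z0; rewrite -/b in Hi; lra.
- apply: Rnot_lt_le => L; apply: nl; right.
  by exists (-1)%Z, Z0, Z0; rewrite -/b in Hi; lra.
Qed.

(** * Portraits made of two disjoint critical chords *)

Definition chord_set (c : R) : {fset R} := [fset frac_part c; frac_part (c + 1 / 3)].
Definition chord_portrait (a b : R) : portrait := [fset chord_set a; chord_set b].

Lemma chord_set_endpoint c x : x \in chord_set c -> endpoint c x.
Proof. by rewrite in_fset2 => /orP [] /eqP ->; [left | right]; apply: frac_eq_mod1. Qed.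

Lemma chord_set_inS c x : x \in chord_set c -> inS x.
Proof. by rewrite in_fset2 => /orP [] /eqP ->; apply: frac_inS. Qed.

Lemma chord_set_card c : #|` chord_set c| = 2%N.
Proof.
rewrite cardfs2; case: eqP => // E.
suff : eq_mod1 c (c + 1 / 3).
  move=> [k Hk]; have A : IZR (-1) < IZR k by lra.
  have B : IZR k < IZR 0 by lra.
  by move: (lt_IZR _ _ A) (lt_IZR _ _ B); lia.
apply: eq_mod1_trans (eq_mod1_sym (frac_eq_mod1 _)) _.
by rewrite E; apply: frac_eq_mod1.
Qed.

Lemma endpoint_outside a b x : a + 1 / 3 < b -> b < a + 2 / 3 ->
  endpoint b x -> outside a x.
Proof. by move=> h1 h2 [[i Hi]|[i Hi]]; exists (Z.opp i); pushZ; lra. Qed.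

Lemma endpoint_outside_r a b x : a + 1 / 3 < b -> b < a + 2 / 3 ->
  endpoint a x -> outside b x.
Proof. by move=> h1 h2 [[i Hi]|[i Hi]]; exists (Z.sub 1 i); pushZ; lra. Qed.

Lemma chord_portraitP a b A : A \in chord_portrait a b -> A = chord_set a \/ A = chord_set b.
Proof. by rewrite in_fset2 => /orP [] /eqP ->; [left | right]. Qed.

Lemma chord_portrait_A3 a b : a + 1 / 3 < b -> b < a + 2 / 3 -> A3 (chord_portrait a b).
Proof.
move=> ab1 ab2.
have ne : chord_set a != chord_set b.
  apply/eqP => E; have : frac_part a \in chord_set b by rewrite -E in_fset2 eqxx.
  move/chord_set_endpoint/(endpoint_outside ab1 ab2)/outside_not_endpoint; apply.
  by left; apply: frac_eq_mod1.
split; first by move=> A /chord_portraitP [->|->] x; apply: chord_set_inS.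
split; first by move=> A /chord_portraitP [->|->]; rewrite chord_set_card.
have sig c x : x \in chord_set c -> sigma3 x = sigma3 (frac_part c).
  move=> Hx; apply/sigma3_eq_mod1.
  have E := eq_mod1_mul3 1 (frac_eq_mod1 c); rewrite /= Rmult_1_r in E.
  apply: eq_mod1_trans (eq_mod1_sym E).
  have [[k Hk]|[k Hk]] := chord_set_endpoint Hx.
  - by exists (Z.mul 3 k); pushZ; lra.
  - by exists (Z.add (Z.mul 3 k) 1); pushZ; lra.
split; first by move=> A /chord_portraitP [->|->] x y /sig -> /sig ->.
split.
  move=> A B /chord_portraitP [->|->] /chord_portraitP [->|->] // _.
  - apply: (@same_side_hulls_disjoint _ _ b); last by move=> x; apply: chord_set_endpoint.
    by right=> x /chord_set_endpoint; apply: endpoint_outside_r.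
  - apply: (@same_side_hulls_disjoint _ _ a); last by move=> x; apply: chord_set_endpoint.
    by right=> x /chord_set_endpoint; apply: endpoint_outside.
rewrite (eq_big_seq (fun _ => 1%N)); last first.
  by move=> A /chord_portraitP [->|->]; rewrite chord_set_card.
rewrite sum1_size; have : #|` chord_portrait a b| = 2%N by rewrite cardfs2 ne.
by [].
Qed.

Lemma in_union_chord_portrait a b x : in_union (chord_portrait a b) x ->
  endpoint a x \/ endpoint b x.
Proof.
by move=> [A [/chord_portraitP [->|->] /chord_set_endpoint]]; [left | right].
Qed.

Definition one_side (c : R) (X : R -> Prop) : Prop :=
  (forall x, X x -> inside c x) \/ (forall x, X x -> outside c x).

Lemma one_side_not_endpoint c X x : one_side c X -> X x -> ~ endpoint c x.
Proof.
by case=> H /H; [apply: inside_not_endpoint | apply: outside_not_endpoint].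
Qed.

Lemma V_chord_portrait a b (X : R -> Prop) : a + 1 / 3 < b -> b < a + 2 / 3 ->
  (forall x, X x -> inS x) -> one_side a X -> one_side b X -> V X (chord_portrait a b).
Proof.
move=> ab1 ab2 XS Xa Xb.
have nu x : X x -> ~ in_union (chord_portrait a b) x.
  by move=> Xx /in_union_chord_portrait []; apply: one_side_not_endpoint Xx.
case: (classic (exists x0, X x0)) => [[x0 Xx0]|nX].
  exists x0; split; first exact: XS.
  split; first exact: nu.
  move=> x Xx; split; first exact: XS.
  split; first exact: XS.
  split; first exact: nu.
  split; first exact: nu.
  have sub (c : R) : one_side c X -> one_side c (fun z => z = x0 \/ z = x).
    by move=> [H|H]; [left | right] => z [->|->]; apply: H.
  move=> A /chord_portraitP [->|->].
  - by apply: (@same_side_hulls_disjoint _ _ a) => [|z]; [apply: sub | apply: chord_set_endpoint].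
  - by apply: (@same_side_hulls_disjoint _ _ b) => [|z]; [apply: sub | apply: chord_set_endpoint].
(* Even for empty X some unlinked class has to be named; the middle of the arc from a to a + 1/3
   represents one. *)
exists (frac_part (a + 1 / 6)); split; first exact: frac_inS.
have [k Hk] := frac_eq_mod1 (a + 1 / 6).
split; last by move=> x Xx; case: nX; exists x.
move=> /in_union_chord_portrait [].
- by apply: inside_not_endpoint; exists (Z.opp k); pushZ; lra.
- by apply: outside_not_endpoint; exists (Z.sub 1 k); pushZ; lra.
Qed.

(** * Neighbourhoods in the compact-unlinked topology *)

Lemma cdist_near_int e x y : inS x -> inS y -> near_int e (x - y) -> cdist x y < e.
Proof.
move=> [x0 x1] [y0 y1] [k Hk]; rewrite /cdist.
have ml := Rmin_l (Rabs (x - y)) (1 - Rabs (x - y)).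
have mr := Rmin_r (Rabs (x - y)) (1 - Rabs (x - y)).
have [lt|ge] := Rle_lt_dec 1 e.
  have : Rabs (x - y) < 1 by apply: Rabs_def1; lra.
  by lra.
have A : IZR (-2) < IZR k by lra.
have B : IZR k < IZR 2 by lra.
have : (k = -1 \/ k = 0 \/ k = 1)%Z by move: (lt_IZR _ _ A) (lt_IZR _ _ B); lia.
case=> [E|[E|E]]; rewrite E in Hk.
- by rewrite Rabs_left in ml mr *; lra.
- by apply: Rle_lt_trans ml _; apply: Rabs_def1; lra.
- by rewrite Rabs_right in ml mr *; lra.
Qed.

Lemma near_int_cdist e x y : inS x -> inS y -> cdist x y < e -> near_int e (x - y).
Proof.
move=> [x0 x1] [y0 y1]; rewrite /cdist /Rmin; case: Rle_dec => _ H.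
  by move/Rabs_def2: H => H; exists Z0; lra.
case: (Rlt_le_dec (x - y) 0) => L.
- by rewrite Rabs_left // in H; exists (-1)%Z; lra.
- by rewrite Rabs_right in H; [exists 1%Z | ]; lra.
Qed.

Lemma near_int_open d x : near_int d x ->
  exists e, 0 < e /\ forall y, near_int e (y - x) -> near_int d y.
Proof.
move=> [k [h1 h2]]; exists (Rmin (x - (IZR k - d)) (IZR k + d - x)).
split; first by apply: Rmin_glb_lt; lra.
move=> y [l Hl]; exists (Z.add k l); pushZ.
have := Rmin_l (x - (IZR k - d)) (IZR k + d - x).
by have := Rmin_r (x - (IZR k - d)) (IZR k + d - x); lra.
Qed.

Definition away (e c x : R) : Prop :=
  ~ near_int e (x - c) /\ ~ near_int e (x - (c + 1 / 3)).

Lemma away_not_endpoint e c x : 0 < e -> away e c x -> ~ endpoint c x.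
Proof. by move=> e0 [n1 n2] [E|E]; [apply: n1 | apply: n2]; apply: eq_mod1_near. Qed.

Lemma inside_away e c x i : away e c x -> c < x + IZR i -> x + IZR i < c + 1 / 3 ->
  c + e <= x + IZR i /\ x + IZR i <= c + 1 / 3 - e.
Proof.
move=> [n1 n2] h1 h2; split; apply: Rnot_lt_le => L.
- by apply: n1; exists (Z.opp i); pushZ; lra.
- by apply: n2; exists (Z.opp i); pushZ; lra.
Qed.

Lemma outside_away e c x i : away e c x -> c + 1 / 3 < x + IZR i -> x + IZR i < c + 1 ->
  c + 1 / 3 + e <= x + IZR i /\ x + IZR i <= c + 1 - e.
Proof.
move=> [n1 n2] h1 h2; split; apply: Rnot_lt_le => L.
- by apply: n2; exists (Z.opp i); pushZ; lra.
- by apply: n1; exists (Z.sub 1 i); pushZ; lra.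
Qed.

Lemma side_stable e c c' x y : away e c x -> near_int e (y - x - (c' - c)) ->
  (inside c x -> inside c' y) /\ (outside c x -> outside c' y).
Proof.
move=> aw [k Hk]; split=> -[i [h1 h2]].
- have := inside_away aw h1 h2 => h.
  by exists (Z.sub i k); pushZ; lra.
- have := outside_away aw h1 h2 => h.
  by exists (Z.sub i k); pushZ; lra.
Qed.

Lemma not_linked_same_side c s x : ~ linked s x c (c + 1 / 3) -> ~ endpoint c x ->
  (inside c s -> inside c x) /\ (outside c s -> outside c x).
Proof.
move=> nl ne; case: (side_cases c x) => // H; split=> // Hs; case: nl; apply: linked_sym.
- exact: linked_swap_r (inside_outside_linked H Hs).
- exact: inside_outside_linked Hs H.
Qed.

Lemma chord_far Th X A x : A3 Th -> S_closed X -> V X Th -> A \in Th -> x \in A ->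
  exists e, 0 < e /\ forall y, X y -> ~ near_int e (y - x).
Proof.
move=> HTh [XS [_ Xc]] [s [sS [_ Hs]]] ATh Ax.
have xS : inS x by case: HTh => /(_ A ATh x Ax).
have nX : ~ X x by move/Hs => [_ [_ [_ [n _]]]]; apply: n; exists A.
have [e [e0 He]] := Xc x (conj xS nX); exists e; split=> // y Xy /near_int_sym N.
by case: (He y (XS y Xy) (cdist_near_int xS (XS y Xy) N)).
Qed.

(** As X is closed, it keeps a positive distance from the endpoints of the chord, and all of it lies
    on the side of the representative s. Moving the chord by less than that distance changes no
    side. *)
Lemma one_side_stable Th X c : A3 Th -> S_closed X -> V X Th -> has_chord Th c ->
  exists e, 0 < e /\ forall c', Rabs (c' - c) < e -> one_side c' X.
Proof.
move=> HTh cX VX [A [ATh [x [y [Ax Ay Ex Ey]]]]].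
have [e1 [e10 H1]] := chord_far HTh cX VX ATh Ax.
have [e2 [e20 H2]] := chord_far HTh cX VX ATh Ay.
exists (Rmin e1 e2); split; first exact: Rmin_glb_lt.
have [s [sS [ns Hs]]] := VX.
have aw z : X z -> away (Rmin e1 e2) c z.
  move=> Xz; split=> N.
  - apply: (H1 z Xz); apply: near_int_mono (Rmin_l e1 e2) _.
    by apply: near_int_eq_mod1 N; have [k Hk] := Ex; exists k; lra.
  - apply: (H2 z Xz); apply: near_int_mono (Rmin_r e1 e2) _.
    by apply: near_int_eq_mod1 N; have [k Hk] := Ey; exists k; lra.
have e0 : 0 < Rmin e1 e2 by apply: Rmin_glb_lt.
have xS z : z \in A -> inS z by case: HTh => + _; apply.
have nes : ~ endpoint c s.
  by case=> E; apply: ns; exists A; split=> //;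
    [have -> : s = x | have -> : s = y] => //; apply: inS_eq => //; try exact: xS;
    apply: eq_mod1_trans E _; apply: eq_mod1_sym.
have same z : X z -> (inside c s -> inside c z) /\ (outside c s -> outside c z).
  move=> Xz; apply: not_linked_same_side; last exact: away_not_endpoint (aw z Xz).
  have [_ [_ [_ [_ D]]]] := Hs z Xz.
  move=> /(linked_eq_mod1 (eq_mod1_refl s) (eq_mod1_refl z) Ex Ey) L.
  by apply: (linked_hulls_meet L _ _ _ _ (D A ATh)); auto.
move=> c' /Rabs_def2 Hc'.
have N z : near_int (Rmin e1 e2) (z - z - (c' - c)) by exists Z0; lra.
have st z (Xz : X z) := side_stable (aw z Xz) (N z).
case: (side_cases c s) => // Hside.
- by left=> z Xz; apply: (proj1 (st z Xz)); apply: (proj1 (same z Xz)).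
- by right=> z Xz; apply: (proj2 (st z Xz)); apply: (proj2 (same z Xz)).
Qed.

(** Only chords contained in the elements of [Th] are used, so a portrait consisting of a triple is
    approximated by pairs of disjoint chords too. *)
Lemma V_stable Th a0 b0 (Xs : list (R -> Prop)) : A3 Th -> has_chord Th a0 -> has_chord Th b0 ->
  (forall X, List.In X Xs -> S_closed X) -> (forall X, List.In X Xs -> V X Th) ->
  exists e, 0 < e /\ forall a b, Rabs (a - a0) < e -> Rabs (b - b0) < e ->
    a + 1 / 3 < b -> b < a + 2 / 3 -> forall X, List.In X Xs -> V X (chord_portrait a b).
Proof.
move=> HTh Ha Hb; elim: Xs => [|X Xs IH] cX VX; first by exists 1; split; [lra | ].
have [e [e0 He]] := IH (fun Y i => cX Y (or_intror i)) (fun Y i => VX Y (or_intror i)).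
have cX0 := cX X (or_introl erefl); have VX0 := VX X (or_introl erefl).
have [ea [ea0 Hea]] := one_side_stable HTh cX0 VX0 Ha.
have [eb [eb0 Heb]] := one_side_stable HTh cX0 VX0 Hb.
exists (Rmin e (Rmin ea eb)); split; first by repeat apply: Rmin_glb_lt.
have m1 := Rmin_l e (Rmin ea eb); have m2 := Rmin_r e (Rmin ea eb).
have m3 := Rmin_l ea eb; have m4 := Rmin_r ea eb.
move=> a b A B ab1 ab2 Y [<-|inY]; last by apply: He => //; lra.
apply: V_chord_portrait => //; first by case: cX0.
- by apply: Hea; lra.
- by apply: Heb; lra.
Qed.

Definition is_side (P : R -> R -> Prop) : Prop := P = inside \/ P = outside.

(** The four choices of sides cover the circle except for the e-neighbourhoods of the four
    endpoints. They are the closed test sets that pin down a portrait. *)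
Definition region (e a b : R) (P Q : R -> R -> Prop) (x : R) : Prop :=
  [/\ inS x, P a x, Q b x, away e a x & away e b x].

Lemma region_closed e a b P Q : 0 < e -> is_side P -> is_side Q ->
  S_closed (region e a b P Q).
Proof.
move=> e0 sP sQ; split; first by move=> x [].
split; first by move=> x [].
move=> x [xS nR].
have opn c u : near_int e (x - (c + u)) -> (forall y, near_int e (y - (c + u)) -> ~ region e a b P Q y) ->
    exists eps, 0 < eps /\ forall y, inS y -> cdist x y < eps -> inS y /\ ~ region e a b P Q y.
  move=> /near_int_open [d [d0 H]] nr; exists d; split=> // y yS /(near_int_cdist xS yS) /near_int_sym N.
  by split=> //; apply: nr; apply: H; move: N; congr near_int; ring.
case: (classic (near_int e (x - (a + 0)))) => [N|na0].
  by apply: opn N _ => y; rewrite Rplus_0_r => N [_ _ _ [n _] _].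
case: (classic (near_int e (x - (a + 1 / 3)))) => [N|na1].
  by apply: opn N _ => y N [_ _ _ [_ n] _].
case: (classic (near_int e (x - (b + 0)))) => [N|nb0].
  by apply: opn N _ => y; rewrite Rplus_0_r => N [_ _ _ _ [n _]].
case: (classic (near_int e (x - (b + 1 / 3)))) => [N|nb1].
  by apply: opn N _ => y N [_ _ _ _ [_ n]].
rewrite Rplus_0_r in na0; rewrite Rplus_0_r in nb0.
have awa : away e a x by split.
have awb : away e b x by split.
exists e; split=> // y yS /(near_int_cdist xS yS) /near_int_sym N.
split=> // -[_ Py Qy _ _]; apply: nR; split=> //.
- have Na : near_int e (y - x - (a - a)) by move: N; congr near_int; ring.
  have [s1 s2] := side_stable awa Na.
  case: (side_cases a x) => [/(away_not_endpoint e0 awa) //|H|H]; case: sP Py => -> // Py.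
  + by case: (inside_not_outside (s1 H) Py).
  + by case: (inside_not_outside Py (s2 H)).
- have Nb : near_int e (y - x - (b - b)) by move: N; congr near_int; ring.
  have [s1 s2] := side_stable awb Nb.
  case: (side_cases b x) => [/(away_not_endpoint e0 awb) //|H|H]; case: sQ Qy => -> // Qy.
  + by case: (inside_not_outside (s1 H) Qy).
  + by case: (inside_not_outside Qy (s2 H)).
Qed.

Lemma between_ints (k l : Z) : IZR l < IZR k -> IZR k < IZR l + 1 -> False.
Proof. by move=> A B; move: (lt_IZR _ _ A) (IZR_lt_succ B); lia. Qed.

(** Otherwise c is near a + 1/3 or b + 1/3, so c + 1/3 is near a + 2/3 or b + 2/3, and these are at
    least 3 e away from all four endpoints. *)
Lemma near_endpoints a b e c : a + 1 / 3 + 3 * e <= b -> b <= a + 2 / 3 - 3 * e ->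
  0 < e -> e <= 1 / 20 -> ~ (away e a c /\ away e b c) ->
  ~ (away e a (c + 1 / 3) /\ away e b (c + 1 / 3)) ->
  near_int e (c - a) \/ near_int e (c - b).
Proof.
move=> ab1 ab2 e0 e1 n1 n2; apply: NNPP => /not_or_and [na nb].
have [k Hk] : exists k, (c - (a + 1 / 3) - IZR k < e /\ - e < c - (a + 1 / 3) - IZR k) \/
    (c - (b + 1 / 3) - IZR k < e /\ - e < c - (b + 1 / 3) - IZR k).
  apply: NNPP => H; apply: n1; split; split=> // -[k Hk]; apply: H; exists k; lra.
have [l Hl] : exists l, [\/ - e < c + 1 / 3 - a - IZR l < e, - e < c + 1 / 3 - (a + 1 / 3) - IZR l < e,
    - e < c + 1 / 3 - b - IZR l < e | - e < c + 1 / 3 - (b + 1 / 3) - IZR l < e].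
  apply: NNPP => H; apply: n2; split; split=> // -[l Hl]; apply: H; exists l;
   [constructor 1 | constructor 2 | constructor 3 | constructor 4]; lra.
have E : IZR (Z.sub l k) = IZR l - IZR k by pushZ.
case: Hk => Hk; case: Hl => Hl;
  first [ by apply: (@between_ints (Z.sub l k) 0); rewrite E; lra
        | by apply: (@between_ints (Z.sub l k) 1); rewrite E; lra
        | by apply: (@between_ints (Z.sub l k) (-1)); rewrite E; lra ].
Qed.

(** An unlinked class avoids the points of its portrait, so no chord endpoint of [Th] lies in a
    region and [near_endpoints] applies. The two chords found are at least 1/3 apart, hence near
    different ones of a and b. *)
Lemma portrait_neighborhood a b e : a + 1 / 3 + 3 * e <= b -> b <= a + 2 / 3 - 3 * e ->
  0 < e -> e <= 1 / 20 -> exists Ys : list (R -> Prop),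
    (forall Y, List.In Y Ys -> S_closed Y) /\
    (forall Y, List.In Y Ys -> V Y (chord_portrait a b)) /\
    forall Th, A3 Th -> (forall Y, List.In Y Ys -> V Y Th) ->
      exists a' b', has_chord Th a' /\ has_chord Th b' /\
        near_int e (a' - a) /\ near_int e (b' - b).
Proof.
move=> ab1 ab2 e0 e1.
pose Ys := [:: region e a b inside inside; region e a b inside outside;
               region e a b outside inside; region e a b outside outside].
have inYs P Q : is_side P -> is_side Q -> List.In (region e a b P Q) Ys.
  by case=> -> [] ->; rewrite /=; tauto.
have Ysin Y : List.In Y Ys -> exists P Q, is_side P /\ is_side Q /\ Y = region e a b P Q.
  rewrite /is_side; case=> [<-|[<-|[<-|[<-|[]]]]].
  - by exists inside, inside; auto.
  - by exists inside, outside; auto.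
  - by exists outside, inside; auto.
  - by exists outside, outside; auto.
exists Ys; split; first by move=> Y /Ysin [P [Q [sP [sQ ->]]]]; apply: region_closed.
split.
  move=> Y /Ysin [P [Q [sP [sQ ->]]]]; apply: V_chord_portrait; try lra.
  - by move=> x [].
  - by case: sP => ->; [left | right] => x [].
  - by case: sQ => ->; [left | right] => x [].
move=> Th HTh VYs; have [c [d [Hc Hd cd1 cd2]]] := portrait_chords HTh.
have near_pt A x u : A \in Th -> x \in A -> eq_mod1 x u -> ~ (away e a u /\ away e b u).
  move=> ATh Ax Ex [[n1 n2] [n3 n4]].
  have aw f : ~ near_int e (u - f) -> ~ near_int e (x - f).
    move=> n N; apply: n; apply: near_int_eq_mod1 N.
    by have [k Hk] := Ex; exists k; lra.
  have awa : away e a x by split; apply: aw.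
  have awb : away e b x by split; apply: aw.
  have xS : inS x by case: HTh => + _; apply; eassumption.
  have side f : away e f x -> exists P, is_side P /\ P f x.
    rewrite /is_side => /(away_not_endpoint e0) ne; case: (side_cases f x) => // H.
    - by exists inside; auto.
    - by exists outside; auto.
  have [P [sP Px]] := side a awa; have [Q [sQ Qx]] := side b awb.
  have [s [_ [_ Hs]]] := VYs _ (inYs P Q sP sQ).
  have [_ [_ [_ [n _]]]] : unlinked Th s x by apply: Hs.
  by apply: n; exists A.
have near_ab f : has_chord Th f -> near_int e (f - a) \/ near_int e (f - b).
  move=> [A [ATh [x [y [Ax Ay Ex Ey]]]]].
  by apply: near_endpoints => //; [apply: near_pt Ex | apply: near_pt Ey]; eassumption.
have apart f : ~ (near_int e (c - f) /\ near_int e (d - f)).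
  move=> [[k Hk] [l Hl]]; have E : IZR (Z.sub l k) = IZR l - IZR k by pushZ.
  by apply: (@between_ints (Z.sub l k) 0); rewrite E; lra.
case: (near_ab c Hc) => Nc; case: (near_ab d Hd) => Nd.
- by case: (apart a).
- by exists c, d.
- by exists d, c.
- by case: (apart b).
Qed.

(** * From wandering gaps to wandering triangles *)

Lemma image3_ext (A B : R -> Prop) : set_eq A B -> set_eq (image3 A) (image3 B).
Proof. by move=> AB w; split=> -[y [/AB Ay ->]]; exists y. Qed.

Lemma critical_ext (A B : R -> Prop) : set_eq A B -> critical A -> critical B.
Proof.
by move=> AB [a [b [/AB Aa [/AB Ab H]]]]; exists a, b.
Qed.

Lemma iter_image3_class lam x n : is_lamination lam -> inS x ->
  exists z, inS z /\ set_eq (iter_image3 n (lam x)) (lam z).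
Proof.
move=> [_ [_ [_ [_ [_ [_ [_ [img _]]]]]]]] xS; elim: n => [|n [z [zS Ez]]]; first by exists x.
have [z' [zS' Ez']] := img z zS; exists z'; split=> // w.
have := image3_ext Ez w; have := Ez' w; rewrite /iter_image3 /=; tauto.
Qed.

Lemma iter_image3_point (A : R -> Prop) u n : A u -> inS u ->
  iter_image3 n A (frac_part (3 ^ n * u)).
Proof.
move=> Au uS; elim: n => [|n IH].
  rewrite /= Rmult_1_l; have -> : frac_part u = u; last by [].
  by apply: inS_eq => //; [apply: frac_inS | apply: frac_eq_mod1].
exists (frac_part (3 ^ n * u)); split=> //; apply: eq_mod1_frac.
have := eq_mod1_mul3 1 (eq_mod1_sym (frac_eq_mod1 (3 ^ n * u))).
by rewrite /= Rmult_1_r Rmult_assoc.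
Qed.

(** Not being precritical keeps the vertices distinct and the images off the critical classes; not
    being preperiodic makes the images different classes. Disjoint hulls then exclude crossings. *)
Lemma wandering_gap_wandering lam x Th a b (t : corner -> R) :
  is_lamination lam -> inS x -> wandering_gap (lam x) -> is_crit_portrait Th ->
  compatible Th lam -> has_chord Th a -> has_chord Th b ->
  (forall i, lam x (t i)) -> (forall i j, i <> j -> t i <> t j) -> wandering a b t.
Proof.
move=> L xS [_ [npp npc]] HTh comp Ha Hb Ht tne.
have [lamS [refl [sym [trans [_ [hd _]]]]]] := L.
pose u n i := frac_part (3 ^ n * t i).
have Eu n i : eq_mod1 (u n i) (3 ^ n * t i) := frac_eq_mod1 _.
have tS i : inS (t i) := proj2 (lamS _ _ (Ht i)).
have class n := iter_image3_class n L xS.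
have pt n i : iter_image3 n (lam x) (u n i) by apply: iter_image3_point.
have distinct n i j : i <> j -> ~ eq_mod1 (3 ^ n * t i) (3 ^ n * t j).
  move=> ij; elim: n => [|n IH].
    by rewrite /= !Rmult_1_l => /(inS_eq (tS i) (tS j)); apply: tne.
  rewrite /= !Rmult_assoc => E; apply: npc; exists n, (u n i), (u n j).
  split; first exact: pt.
  split; first exact: pt.
  split.
    move=> Eq; apply: IH; apply: eq_mod1_trans (eq_mod1_sym (Eu n i)) _.
    by rewrite Eq; apply: Eu.
  apply/sigma3_eq_mod1; have M k := eq_mod1_mul3 1 (Eu n k); rewrite /= Rmult_1_r in M.
  by apply: eq_mod1_trans (M i) _; apply: eq_mod1_trans E (eq_mod1_sym (M j)).
have sub z w : lam z w -> forall v, lam w v -> lam z v by move=> zw v; apply: trans zw.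
have classes_disjoint n m z w : (n < m)%N -> set_eq (iter_image3 n (lam x)) (lam z) ->
    set_eq (iter_image3 m (lam x)) (lam w) -> ~ lam z w.
  move=> nm Ez Ew zw; apply: npp; exists n, m; split=> // v.
  have := Ez v; have := Ew v; have := sub _ _ zw v; have := sub _ _ (sym _ _ zw) v.
  tauto.
have apart n m : n <> m -> exists z w, [/\ inS z, inS w, ~ lam z w,
    (forall i, lam z (u n i)) & (forall i, lam w (u m i))].
  move=> nm; have [z [zS Ez]] := class n; have [w [wS Ew]] := class m; exists z, w; split=> //.
  - move/eqP: nm; rewrite neq_ltn => /orP [lt|lt] zw.
    + exact: (classes_disjoint n m z w lt Ez Ew zw).
    + exact: (classes_disjoint m n w z lt Ew Ez (sym _ _ zw)).
  - by move=> i; apply/Ez; apply: pt.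
  - by move=> i; apply/Ew; apply: pt.
split.
- exact: distinct.
- move=> n m i j nm E; have [z [w [zS wS nzw Hz Hw]]] := apart n m nm.
  apply: nzw; apply: trans (Hz i) _; apply: sym.
  have -> : u n i = u m j by apply: eq_mod1_frac.
  exact: Hw.
- move=> n m i j k l nm; have [z [w [zS wS nzw Hz Hw]]] := apart n m nm.
  move=> /(linked_eq_mod1 (Eu n i) (Eu n j) (Eu m k) (Eu m l)) H.
  exact: (linked_hulls_meet H (Hz i) (Hz j) (Hw k) (Hw l) (hd z w zS wS nzw)).
- move=> n i j e He.
  have {}He : has_chord Th e by case: He => ->.
  have [A [ATh [p [q [Ap Aq Ep Eq]]]]] := He.
  have [c Hc] := comp A ATh; have cS : inS c := proj1 (lamS _ _ (Hc p Ap)).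
  have crit : critical (lam c).
    exists p, q; split; first exact: Hc.
    split; first exact: Hc.
    split.
      move=> pq; rewrite pq in Ep; have [k Hk] := Ep; have [l Hl] := Eq.
      by apply: (@between_ints (Z.sub k l) 0); rewrite minus_IZR; lra.
    apply/sigma3_eq_mod1; have [k Hk] := Ep; have [l Hl] := Eq.
    by exists (Z.sub (Z.mul 3 (Z.sub k l)) 1); pushZ; lra.
  have [z [zS Ez]] := class n.
  have nzc : ~ lam z c.
    move=> zc; apply: npc; exists n; apply: critical_ext crit => v.
    by have := Ez v; have := sub _ _ zc v; have := sub _ _ (sym _ _ zc) v; tauto.
  have Hz k : lam z (u n k) by apply/Ez; apply: pt.
  move=> /(linked_eq_mod1 (Eu n i) (Eu n j) Ep Eq) H.
  exact: (linked_hulls_meet H (Hz i) (Hz j) (Hc p Ap) (Hc q Aq) (hd z c zS cS nzc)).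
Qed.

(** * Decomposition into nowhere dense sets *)

(** The lower bound on the sides depends on n alone, which keeps limits of such triangles
    nondegenerate. *)
Definition wide_gap_portrait (n : nat) (Th : portrait) : Prop :=
  A3 Th /\ exists lam x (t : corner -> R), [/\ is_lamination lam, compatible Th lam,
    inS x, wandering_gap (lam x) & (forall i, lam x (t i)) /\
    forall i j, i <> j -> ~ near_int (/ INR n.+1) (t i - t j)].

Lemma WT3_wide_gap Th : WT3 Th <-> exists n, wide_gap_portrait n Th.
Proof.
split=> [[HTh [lam [[L [x [xS W]]] comp]]]|[n [HTh [lam [x [t [L comp xS W _]]]]]]]; last first.
  by split=> //; exists lam; split=> //; split=> //; exists x.
have [[p [q [r [Hp [Hq [Hr [pq [pr qr]]]]]]]] _] := W.
have lamS := proj1 L.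
have far y z : lam x y -> lam x z -> y <> z ->
    exists d, 0 < d /\ ~ near_int d (y - z).
  move=> /lamS [_ yS] /lamS [_ zS] yz; apply: not_eq_mod1_far.
  by move=> /(inS_eq yS zS).
have [d1 [d10 f1]] := far p q Hp Hq pq.
have [d2 [d20 f2]] := far p r Hp Hr pr.
have [d3 [d30 f3]] := far q r Hq Hr qr.
pose d := Rmin d1 (Rmin d2 d3).
have d0 : 0 < d by repeat apply: Rmin_glb_lt.
have [m1 m2] : d <= d1 /\ d <= Rmin d2 d3 by split; [apply: Rmin_l | apply: Rmin_r].
have [m3 m4] := (Rmin_l d2 d3, Rmin_r d2 d3).
have [n Hn] := INR_unbounded (/ d); exists n; split=> //.
have nd : / INR n.+1 < d.
  rewrite -(Rinv_inv d); apply: Rinv_0_lt_contravar; first exact: Rinv_0_lt_compat.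
  by rewrite S_INR; lra.
exists lam, x, (fun i => match i with C0 => p | C1 => q | C2 => r end).
split=> //; split; first by case.
by case; case=> // _ N;
  first [ apply: f1; apply: near_int_mono N; lra
        | apply: f2; apply: near_int_mono N; lra
        | apply: f3; apply: near_int_mono N; lra
        | apply: f1; apply: near_int_mono (near_int_sym N); lra
        | apply: f2; apply: near_int_mono (near_int_sym N); lra
        | apply: f3; apply: near_int_mono (near_int_sym N); lra ].
Qed.

Lemma wide_gap_portraits_limit n a b : a + 1 / 3 < b -> b < a + 2 / 3 ->
  A3_closure (wide_gap_portrait n) (chord_portrait a b) ->
  exists t, limit_triangle a b t /\ nondegenerate t.
Proof.
move=> ab1 ab2 [_ clo].
pose mu := / INR n.+1.
have mu0 : 0 < mu by apply: Rinv_0_lt_compat; apply: lt_0_INR; lia.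
pose P (e : R) (t : corner -> R) :=
  (exists a' b', wandering a' b' t /\ near_int e (a' - a) /\ near_int e (b' - b)) /\
  forall i j, i <> j -> ~ near_int mu (t i - t j).
have Pmono d e t : d <= e -> P d t -> P e t.
  move=> de [[a' [b' [W [Na Nb]]]] far]; split=> //; exists a', b'; split=> //.
  by split; [apply: near_int_mono Na | apply: near_int_mono Nb].
have Pne e : 0 < e -> exists t, P e t.
  move=> e0; pose m := Rmin (b - a - 1 / 3) (a + 2 / 3 - b).
  have m1 : m <= b - a - 1 / 3 := Rmin_l _ _.
  have m2 : m <= a + 2 / 3 - b := Rmin_r _ _.
  have m0 : 0 < m by apply: Rmin_glb_lt; lra.
  (* The bounds m / 3 and 1 / 20 are those required by [portrait_neighborhood]. *)
  pose d := Rmin e (Rmin (m / 3) (1 / 20)).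
  have d0 : 0 < d by repeat apply: Rmin_glb_lt; lra.
  have [d1 d2] : d <= e /\ d <= Rmin (m / 3) (1 / 20) by split; [apply: Rmin_l | apply: Rmin_r].
  have [d3 d4] := (Rmin_l (m / 3) (1 / 20), Rmin_r (m / 3) (1 / 20)).
  have [||||Ys [cY [VY HY]]] := @portrait_neighborhood a b d; try lra.
  pose U Th := A3 Th /\ forall Y, List.In Y Ys -> V Y Th.
  have oU : A3_open U.
    split; first by move=> Th [].
    by move=> Th [_ VTh]; exists Ys; split=> //; split=> // Th' HTh' VTh'.
  have [|Th [[HTh VTh] [_ [lam [x [t [L comp xS W [Ht far]]]]]]]] := clo U oU.
    by split=> //; apply: chord_portrait_A3.
  have [a' [b' [Ha [Hb [Na Nb]]]]] := HY Th HTh VTh.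
  exists t; split=> //; exists a', b'.
  split; last by split; [apply: near_int_mono Na | apply: near_int_mono Nb].
  apply: (wandering_gap_wandering L xS W HTh comp Ha Hb Ht) => i j ij E.
  by apply: (far i j ij); rewrite E; apply: (eq_mod1_near mu0); apply: eq_mod1_refl.
have [x Hx] := cluster_triangle Pmono Pne id.
exists x; split.
  move=> e /Hx [t [[[a' [b' [W [Na Nb]]]] _] Nt]].
  by exists a', b', t; split=> //; split.
move=> i j ij E; have e0 : 0 < mu / 2 by lra.
have [t [[_ far] Nt]] := Hx _ e0; apply: (far i j ij).
have [k Hk] := Nt i; have [l Hl] := Nt j; have [z Hz] := E; rewrite /id in Hk Hl.
by exists (Z.add (Z.sub k l) z); pushZ; lra.
Qed.

Theorem theorem4p4 : first_category WT3.
Proof.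
exists wide_gap_portrait; split; last exact: WT3_wide_gap.
move=> n; split=> [Th []|Th [U [[UA3 Uopen] [UTh Uclo]]]] //.
have [a0 [b0 [Ha Hb ab1 ab2]]] := portrait_chords (UA3 Th UTh).
have [Xs [cX [VX HX]]] := Uopen Th UTh.
have [e [e0 He]] := V_stable (UA3 Th UTh) Ha Hb cX VX.
(* The generic portrait found in U lies in the closure, so it would carry a nondegenerate limit
   triangle. *)
have [a [b [Na [Nb [ab3 [ab4 no]]]]]] := generic_parameters e0 ab1 ab2.
have Uab : U (chord_portrait a b).
  by apply: HX; [apply: chord_portrait_A3 | apply: He].
have [t [Lt nd]] := wide_gap_portraits_limit ab3 ab4 (Uclo _ Uab).
exact: no Lt nd.
Qed.
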